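(* Let $A \in \mathbb{C}^{n\times p}$, $B \in \mathbb{C}^{m\times q}$, $C \in \mathbb{C}^{n\times q}$, $D \in \mathbb{C}^{n}_{\mathrm{H}}$ and $M \in \mathbb{C}^{q}_{\mathrm{H}}$ be given, and define $\phi(X) = (AXB + C)M(AXB + C)^{*} + D$ for $X \in \mathbb{C}^{p\times m}$. Define $$N_1 = \begin{bmatrix} D + CMC^{*} & A \\ A^{*} & 0\end{bmatrix},\quad N_2 = \begin{bmatrix} D + CMC^{*} & CMB^{*} & A \\ A^{*} & 0 & 0\end{bmatrix},$$ $$N_3 = \begin{bmatrix} D + CMC^{*} & CMB^{*} \\ BMC^{*} & BMB^{*}\end{bmatrix},\quad N_4 = \begin{bmatrix} D + CMC^{*} & CMB^{*} & A \\ BMC^{*} & BMB^{*} & 0\end{bmatrix},$$ and $s_1 = r(N_1) - 2r(N_2)$, $s_2 = r(N_3) - 2r(N_4)$, $s_3 = i_{+}(N_1) + i_{-}(N_3) - r(N_2) - r(N_4)$, $s_4 = i_{-}(N_1) + i_{+}(N_3) - r(N_2) - r(N_4)$. Then \begin{align*} \max_{X\in \mathbb{C}^{p\times m}} r[\phi(X)] &= \min\{ r[\,D + CMC^{*},\, CMB^{*},\, A\,],\ r(N_1),\ r(N_3)\},\\ \min_{X\in \mathbb{C}^{p\times m}} r[\phi(X)] &= 2r[\,D + CMC^{*},\, CMB^{*},\, A\,] + \max\{s_1, s_2, s_3, s_4\},\\ \max_{X\in \mathbb{C}^{p\times m}} i_{\pm}[\phi(X)] &= \min\{ i_{\pm}(N_1),\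 i_{\pm}(N_3)\},\\ \min_{X\in \mathbb{C}^{p\times m}} i_{\pm}[\phi(X)] &= r[\,D + CMC^{*},\, CMB^{*},\, A\,] + \max\{ i_{\pm}(N_1) - r(N_2),\ i_{\pm}(N_3) - r(N_4)\}. \end{align*}
   Context: $\mathbb{C}^{k}_{\mathrm{H}}$ denotes the set of $k\times k$ complex Hermitian matrices; $A^{*}$ is the conjugate transpose, $r(\cdot)$ the rank; for a Hermitian matrix $H$, $i_{+}(H)$ and $i_{-}(H)$ denote the numbers of positive and negative eigenvalues of $H$ counted with multiplicities. $[\,U, V, W\,]$ denotes the row block matrix formed from $U$, $V$, $W$. *)

(* Defs.v *)
From HB Require Import structures.
From mathcomp Require Import all_boot all_order all_algebra.
Set Implicit Arguments. Unset Strict Implicit. Unset Printing Implicit Defensive.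
Import Order.TTheory GRing.Theory Num.Theory.
Local Open Scope ring_scope.

(* Complex numbers: any numeric algebraically closed field C (covers the
   complex numbers; e.g. algC, or complex R for a real closed R). *)

Definition conjtmx (C : numClosedFieldType) m n (A : 'M[C]_(m, n)) : 'M[C]_(n, m) :=
  (map_mx Num.conj A)^T.

Definition hermitian_mx (C : numClosedFieldType) n (H : 'M[C]_n) : Prop :=
  conjtmx H = H.

(* eigenvalues_mx of a square matrix, listed with algebraic multiplicity:
   the roots of its (monic) characteristic polynomial *)
Definition eigenvalues_mx (C : numClosedFieldType) n (H : 'M[C]_n) : seq C :=
  sval (closed_field_poly_normal (char_poly H)).

Definition inertia_pos (C : numClosedFieldType) n (H : 'M[C]_n) : nat :=
  count (fun z => 0 < z) (eigenvalues_mx H).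
Definition inertia_neg (C : numClosedFieldType) n (H : 'M[C]_n) : nat :=
  count (fun z => z < 0) (eigenvalues_mx H).

(* Main.v *)
(* Put N = [[P, Q], [Q^*, S]] on W = C^(n+m).  Then phi(X) = [I, AX] N [I, AX]^*
   is the restriction of the Hermitian form N to the row space L of [I, AX].  Let
   K = {(u, 0) : uA = 0} and F = 0 + C^m; as X varies, L runs over the complements
   of F in W that contain K, and the ranks and inertias of N1, ..., N4 are those of
   N between K, K + F and W.  All inequalities are dimension counts.

   The maxima are attained by enlarging K one vector outside K + F at a time.  For
   the minima one enlarges K by vectors that do not increase the bound: vectors
   pairing nontrivially with the radical of K orthogonal to F while there are any,
   then isotropic vectors of K^perp in general position.  When there is no such
   vector, K^perp is semidefinite or lies in K + (K + F)^perp, and a suitable L can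
   be written down.  The same L minimizes both inertias, hence the rank, which is
   their sum. *)
Require Import Defs.
From HB Require Import structures.
From mathcomp Require Import all_boot all_order all_algebra zify.
Import Order.TTheory GRing.Theory Num.Theory.
Local Open Scope ring_scope.
Set Implicit Arguments. Unset Strict Implicit. Unset Printing Implicit Defensive.

Local Notation "A ^h" := (conjtmx A) (at level 8, format "A ^h").

(** * Conjugate transposes and the spectral theorem *)

Section ConjTranspose.
Variable C : numClosedFieldType.

Lemma conjtmxK m n (A : 'M[C]_(m, n)) : A^h^h = A.
Proof. by apply/matrixP=> i j; rewrite !mxE conjCK. Qed.

Lemma conjtmxM m n p (A : 'M[C]_(m, n)) (B : 'M_(n, p)) :
  (A *m B)^h = B^h *m A^h.
Proof. by rewrite /conjtmx map_mxM trmx_mul. Qed.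

Lemma conjtmxD m n (A B : 'M[C]_(m, n)) : (A + B)^h = A^h + B^h.
Proof. by rewrite /conjtmx map_mxD linearD. Qed.

Lemma conjtmxN m n (A : 'M[C]_(m, n)) : (- A)^h = - A^h.
Proof. by rewrite /conjtmx map_mxN linearN. Qed.

Lemma conjtmxZ m n a (A : 'M[C]_(m, n)) : (a *: A)^h = a^* *: A^h.
Proof. by rewrite /conjtmx map_mxZ linearZ. Qed.

Lemma conjtmx0 m n : (0 : 'M[C]_(m, n))^h = 0.
Proof. by rewrite /conjtmx map_mx0 trmx0. Qed.

Lemma conjtmx1 n : (1%:M : 'M[C]_n)^h = 1%:M.
Proof. by rewrite /conjtmx map_mx1 trmx1. Qed.

Lemma conjtmx_row m n p (A : 'M[C]_(m, n)) (B : 'M_(m, p)) :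
  (row_mx A B)^h = col_mx A^h B^h.
Proof. by rewrite /conjtmx map_row_mx tr_row_mx. Qed.

Lemma conjtmx_col m n p (A : 'M[C]_(m, n)) (B : 'M_(p, n)) :
  (col_mx A B)^h = row_mx A^h B^h.
Proof. by rewrite /conjtmx map_col_mx tr_col_mx. Qed.

Lemma rank_conjtmx m n (A : 'M[C]_(m, n)) : \rank A^h = \rank A.
Proof. by rewrite /conjtmx mxrank_tr mxrank_map. Qed.

Lemma hermitian_sandwich m n (H : 'M[C]_n) (K : 'M_(m, n)) :
  hermitian_mx H -> hermitian_mx (K *m H *m K^h).
Proof. by move=> hH; rewrite /hermitian_mx !conjtmxM conjtmxK hH mulmxA. Qed.

Lemma hermitian_opp n (H : 'M[C]_n) : hermitian_mx H -> hermitian_mx (- H).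
Proof. by move=> hH; rewrite /hermitian_mx conjtmxN hH. Qed.

Lemma hermitian_spectral n (H : 'M[C]_n) : hermitian_mx H ->
  exists (U : 'M[C]_n) (d : 'rV[C]_n),
  [/\ U *m U^h = 1%:M, H = U^h *m diag_mx d *m U
    & forall i, d 0 i \is Num.real].
Proof.
move=> hH.
have hermH : H \is hermsymmx.
  apply/is_hermitianmxP; rewrite expr0 scale1r.
  by rewrite -[LHS]hH /conjtmx map_trmx.
exists (spectralmx H), (spectral_diag H).
have uU := spectral_unitarymx H.
have e : invmx (spectralmx H) = (spectralmx H)^h.
  by rewrite invmx_unitary // /conjtmx map_trmx.
split.
- by rewrite -e mulmxV // spectral_unit.
- rewrite -e; exact/orthomx_spectralP/hermitian_normalmx.
- by move=> i; have /mxOverP := hermitian_spectral_diag_real hermH; apply.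
Qed.

(** Unitary conjugation leaves the characteristic polynomial unchanged, and that of a diagonal
    matrix splits along its entries. *)
Lemma eigenvalues_spectral n (U : 'M[C]_n) d :
  U *m U^h = 1%:M ->
  perm_eq (eigenvalues_mx (U^h *m diag_mx d *m U)) [seq d 0 i | i <- enum 'I_n].
Proof.
move=> UU.
rewrite /eigenvalues_mx; case: closed_field_poly_normal => s /= es.
apply: prod_XsubC_eq; rewrite big_map big_enum /=.
have -> : \prod_(z <- s) ('X - z%:P) = char_poly (U^h *m diag_mx d *m U).
  by rewrite [RHS]es (monicP (char_poly_monic _)) scale1r.
have UU' : U^h *m U = 1%:M by apply: mulmx1C.
have -> : char_poly (U^h *m diag_mx d *m U) = char_poly (diag_mx d).
  rewrite /char_poly /char_poly_mx.
  have -> : 'X%:M - map_mx polyC (U^h *m diag_mx d *m U) =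
    map_mx polyC U^h *m ('X%:M - map_mx polyC (diag_mx d)) *m map_mx polyC U.
    rewrite !map_mxM mulmxBr mulmxBl; congr (_ - _).
    by rewrite mul_mx_scalar -scalemxAl -map_mxM UU' map_mx1 scalemx1.
  rewrite !det_mulmx mulrAC -det_mulmx -map_mxM UU' map_mx1 det1 mul1r //.
rewrite char_poly_trig.
  by apply: eq_bigr => i _; rewrite !mxE eqxx.
by apply/is_trig_mxP => i j lt; rewrite mxE -val_eqE ltn_eqF.
Qed.

Lemma rank_diag_mx_le n (d : 'rV[C]_n) :
  (\rank (diag_mx d) <= #|[pred i | d 0%R i != 0%R]|)%N.
Proof.
rewrite diag_mx_sum_delta (bigID (fun i => d 0 i != 0)) /= [X in _ + X]big1.
  rewrite addr0 -sum1_card.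
  elim/big_rec2: _ => [|i r E _ le]; first by rewrite mxrank0.
  apply: leq_trans (mxrank_add _ _) _; apply: leq_add => //.
  by apply: leq_trans (mxrank_scale _ _) _; rewrite mxrank_delta.
by move=> i; rewrite negbK => /eqP->; rewrite scale0r.
Qed.

(** For the lower bound, entrywise inversion turns [diag_mx d] into the projector onto the nonzero
    entries, whose complement has rank at most the number of zeros. *)
Lemma rank_diag_mx n (d : 'rV[C]_n) :
  \rank (diag_mx d) = #|[pred i | d 0%R i != 0%R]|.
Proof.
apply/eqP; rewrite eqn_leq rank_diag_mx_le /=.
pose e := \row_i (d 0 i != 0)%:R : 'rV[C]_n.
pose d' := \row_i (d 0 i)^-1 : 'rV[C]_n.
have e1 : diag_mx d *m diag_mx d' = diag_mx e.
  rewrite mulmx_diag; congr diag_mx; apply/rowP => i; rewrite !mxE.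
  by case: eqP => [->|/eqP h]; rewrite ?mul0r // divff.
have := mxrankM_maxl (diag_mx d) (diag_mx d'); rewrite e1.
apply: leq_trans.
have := mxrank_add (diag_mx e) (1%:M - diag_mx e).
rewrite addrC subrK mxrank1 => h.
have e2 : 1%:M - diag_mx e = diag_mx (\row_i (d 0 i == 0)%:R).
  apply/matrixP => i j; rewrite !mxE; case: (i == j); rewrite ?mulr0n ?mulr1n ?subrr //.
  by case: eqP; rewrite ?subr0 ?subrr.
have := rank_diag_mx_le (\row_i (d 0 i == 0)%:R); rewrite -e2 => h2.
have := cardC [pred i | d 0 i != 0]; rewrite card_ord => h3.
have h4 : #|[pred i | (\row_i (d 0 i == 0)%:R : 'rV[C]_n) 0 i != 0]|
        = #|[predC [pred i | d 0 i != 0]]|.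
  by apply: eq_card => i; rewrite !inE mxE negbK; case: (d 0 i == 0); rewrite ?oner_eq0 ?eqxx.
rewrite h4 in h2; rewrite -(leq_add2r #|[predC [pred i | d 0 i != 0]]|) h3.
by apply: leq_trans h _; rewrite leq_add2l.
Qed.

End ConjTranspose.

(** * Inertia of a Hermitian matrix *)

Lemma count_enum (T : finType) (p : pred T) : count p (enum T) = #|[pred x | p x]|.
Proof. by rewrite enumT -size_filter cardE /enum_mem. Qed.

Section Inertia.
Variable C : numClosedFieldType.

Definition sqform n (N : 'M[C]_n) (u : 'rV_n) : C := (u *m N *m u^h) 0 0.

Definition posdef k n (N : 'M[C]_n) (P : 'M[C]_(k, n)) :=
  forall u : 'rV_n, (u <= P)%MS -> u != 0 -> 0 < sqform N u.

Definition nonpos k n (N : 'M[C]_n) (P : 'M[C]_(k, n)) :=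
  forall u : 'rV_n, (u <= P)%MS -> sqform N u <= 0.

Lemma sqformE k n (N : 'M[C]_n) (K : 'M_(k, n)) (u : 'rV_k) :
  sqform N (u *m K) = sqform (K *m N *m K^h) u.
Proof. by rewrite /sqform conjtmxM !mulmxA. Qed.

Lemma sqform_diag n (d u : 'rV[C]_n) :
  sqform (diag_mx d) u = \sum_i d 0 i * `|u 0 i| ^+ 2.
Proof.
rewrite /sqform mxE; apply: eq_bigr => i _.
by rewrite mul_mx_diag !mxE normCK mulrAC mulrC mulrA.
Qed.

(** A nonzero common vector would have a value both positive and nonpositive, so the two spaces are
    independent. *)
Lemma posdef_nonpos_cap k l n (N : 'M[C]_n) (P : 'M_(k, n)) (Q : 'M_(l, n)) :
  posdef N P -> nonpos N Q -> (\rank P + \rank Q <= n)%N.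
Proof.
move=> hP hQ; rewrite -mxrank_sum_cap.
suff -> : (P :&: Q)%MS = 0 by rewrite mxrank0 addn0 rank_leq_col.
apply/eqP; rewrite -submx0; apply/rV_subP => u; rewrite sub_capmx => /andP[uP uQ].
rewrite submx0; apply: contraT => u0.
by have := lt_le_trans (hP _ uP u0) (hQ _ uQ); rewrite ltxx.
Qed.

(** [P] and [Q] are spanned by the eigenvectors with positive and with nonpositive eigenvalue. This
    turns the eigenvalue count into dimensions of subspaces, as in Sylvester's law. *)
Lemma inertia_pos_splitting n (H : 'M[C]_n) : hermitian_mx H ->
  exists P Q : 'M[C]_n, [/\ posdef H P, nonpos H Q, \rank P = inertia_pos H
    & (inertia_pos H + \rank Q = n)%N].
Proof.
move=> hH; have [U [d [UU eH dR]]] := hermitian_spectral hH.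
have eI : inertia_pos H = #|[pred i | 0 < d 0%R i]|.
  rewrite /inertia_pos {1}eH (permP (eigenvalues_spectral _ UU)) count_map.
  by rewrite count_enum.
(* The 0/1 indicator of the positive ([b = true]) or nonpositive eigenvalues; [diag_mx (e b) *m U]
   keeps the corresponding rows of [U]. *)
pose e (b : bool) := \row_i ((0 < d 0 i) == b)%:R : 'rV[C]_n.
have Uf : row_free U by apply/row_freeP; exists U^h.
have rk b : \rank (diag_mx (e b) *m U) = #|[pred i | (0 < d 0%R i) == b]|.
  rewrite mxrankMfree // rank_diag_mx; apply: eq_card => i; rewrite !inE mxE.
  by case: (_ == b); rewrite ?oner_eq0 ?eqxx.
have sq b (x : 'rV_n) : sqform H (x *m (diag_mx (e b) *m U)) =
    \sum_(i | (0 < d 0 i) == b) d 0 i * `|x 0 i| ^+ 2.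
  rewrite mulmxA sqformE.
  have -> : U *m H *m U^h = diag_mx d by rewrite {1}eH !mulmxA UU mul1mx -mulmxA UU mulmx1.
  rewrite sqform_diag [RHS]big_mkcond; apply: eq_bigr => i _.
  rewrite mul_mx_diag !mxE; case: eqP; rewrite ?mulr1 // mulr0 normr0 expr0n mulr0 //.
exists (diag_mx (e true) *m U), (diag_mx (e false) *m U); split.
- move=> u /submxP[x ->] nz; rewrite sq.
  rewrite lt_def sumr_ge0 ?andbT; last first.
    by move=> i /eqP di; rewrite mulr_ge0 ?exprn_ge0 // ltW.
  apply: contra_neqN nz => /eqP/psumr_eq0P s0.
  have xe : x *m diag_mx (e true) = 0.
    apply/rowP => i; rewrite mul_mx_diag !mxE; case: eqP => di; rewrite ?mulr0 // mulr1.
    have ge j : (0 < d 0 j) == true -> 0 <= d 0 j * `|x 0 j| ^+ 2.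
      by move=> /eqP hj; rewrite mulr_ge0 ?exprn_ge0 // ltW.
    have /eqP := s0 ge i (introT eqP di).
    by rewrite mulf_eq0 (gt_eqF di) expf_eq0 /= normr_eq0 => /eqP.
  by rewrite mulmxA xe mul0mx.
- move=> u /submxP[x ->]; rewrite sq sumr_le0 // => i /eqP di.
  rewrite mulr_le0_ge0 ?exprn_ge0 //.
  by have := real_leNgt (dR i) (real0 C); rewrite di.
- by rewrite rk eI; apply: eq_card => i; rewrite !inE eqb_id.
- rewrite rk eI -[RHS](card_ord n) -(cardC [pred i | 0 < d 0 i]); congr (_ + _)%N.
  by apply: eq_card => i; rewrite !inE eqbF_neg.
Qed.

Lemma rank_inertia n (H : 'M[C]_n) : hermitian_mx H ->
  \rank H = (inertia_pos H + inertia_neg H)%N.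
Proof.
move=> hH; have [U [d [UU eH dR]]] := hermitian_spectral hH.
have Uf : row_free U by apply/row_freeP; exists U^h.
have -> : \rank H = #|[pred i | d 0%R i != 0%R]|.
  rewrite eH mxrankMfree // -rank_diag_mx -rank_conjtmx conjtmxM conjtmxK mxrankMfree //.
  by rewrite rank_conjtmx.
rewrite /inertia_pos /inertia_neg {1 2}eH !(permP (eigenvalues_spectral _ UU)) !count_map.
rewrite -count_enum.
rewrite -(count_predUI) [X in (_ + X)%N](@eq_count _ _ pred0) ?count_pred0 ?addn0.
  rewrite enumT; apply: eq_count => i /=.
  by rewrite real_neqr_lt ?real0 // orbC.
by move=> i /=; apply/negP => /andP[h1 h2]; have := lt_trans h1 h2; rewrite ltxx.
Qed.

Lemma inertia_negE n (H : 'M[C]_n) : hermitian_mx H ->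
  inertia_neg H = inertia_pos (- H).
Proof.
move=> hH; have [U [d [UU eH dR]]] := hermitian_spectral hH.
have -> : - H = U^h *m diag_mx (- d) *m U by rewrite linearN /= mulmxN mulNmx -eH.
rewrite /inertia_pos /inertia_neg {1}eH !(permP (eigenvalues_spectral _ UU)) !count_map.
by apply: eq_count => i /=; rewrite !mxE oppr_gt0.
Qed.

End Inertia.

(** * Restriction of a Hermitian form to a subspace *)

(* Positive index of [N] on the row space of [K]; the negative index is that of
   [- N].  Locked because unification otherwise tries to compute with it. *)
HB.lock Definition pidx (C : numClosedFieldType) k n
    (N : 'M[C]_n) (K : 'M[C]_(k, n)) := inertia_pos (K *m N *m K^h).

(* The ring structure of [C] is reached through several coercion paths, which
   [lia] does not identify. *)
Ltac rank_lia :=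
  repeat match goal with C : numClosedFieldType |- context [@mulmx ?R] =>
    progress change (@mulmx R) with (@mulmx C) end;
  repeat match goal with C : numClosedFieldType |- context [@scalar_mx ?V ?n ?a] =>
    progress change (@scalar_mx V n a) with (@scalar_mx C n 1) end;
  repeat match goal with |- context [@mxrank ?F ?m ?n ?A] =>
    generalize (@mxrank F m n A); intro end;
  repeat match goal with |- context [@inertia_pos ?F ?n ?A] =>
    generalize (@inertia_pos F n A); intro end;
  repeat match goal with |- context [@pidx ?F ?k ?n ?A ?B] =>
    generalize (@pidx F k n A B); intro end;
  lia.


Section Index.
Variable C : numClosedFieldType.



(** The orthogonal complement of the row space of [V] for the form [N]; it always contains the
    radical [kermx N]. *)
Definition perp k n (N : 'M[C]_n) (V : 'M[C]_(k, n)) := kermx (N *m V^h).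

Lemma posdefS k l n (N : 'M[C]_n) (P : 'M_(k, n)) (Q : 'M_(l, n)) :
  (P <= Q)%MS -> posdef N Q -> posdef N P.
Proof. by move=> PQ dQ u uP; apply: dQ; apply: submx_trans PQ. Qed.

Lemma nonposS k l n (N : 'M[C]_n) (P : 'M_(k, n)) (Q : 'M_(l, n)) :
  (P <= Q)%MS -> nonpos N Q -> nonpos N P.
Proof. by move=> PQ dQ u uP; apply: dQ; apply: submx_trans PQ. Qed.

Lemma sqform0 n (N : 'M[C]_n) : sqform N 0 = 0.
Proof. by rewrite /sqform !mul0mx mxE. Qed.

Lemma sqformN n (N : 'M[C]_n) u : sqform (- N) u = - sqform N u.
Proof. by rewrite /sqform mulmxN mulNmx mxE. Qed.

Lemma sub_perp k l n (N : 'M[C]_n) (U : 'M_(k, n)) (V : 'M_(l, n)) :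
  (U <= perp N V)%MS = (U *m N *m V^h == 0).
Proof. by rewrite sub_kermx mulmxA. Qed.

Lemma sub_perp1 k n (N : 'M[C]_n) (U : 'M_(k, n)) :
  (U <= perp N (1%:M : 'M_n))%MS = (U <= kermx N)%MS.
Proof. by rewrite /perp conjtmx1 mulmx1. Qed.

(** Rank-nullity for the pairing with [V] restricted to [U]; it converts the ranks of the statement
    into dimensions of orthogonal spaces. *)
Lemma rank_form k l n (N : 'M[C]_n) (U : 'M_(k, n)) (V : 'M_(l, n)) :
  (\rank (U *m N *m V^h) + \rank (U :&: perp N V) = \rank U)%N.
Proof. by rewrite -mulmxA mxrank_mul_ker. Qed.

Lemma mulmx_sum_perp k l n (N : 'M[C]_n) (U : 'M_(k, n)) (V : 'M_(l, n)) :
  reflect (forall u v : 'rV_n, (u <= U)%MS -> (v <= V)%MS -> u *m N *m v^h = 0)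
          (U <= perp N V)%MS.
Proof.
rewrite sub_perp; apply: (iffP eqP) => [e u v /submxP[x ->] /submxP[y ->]|h].
  rewrite conjtmxM -!mulmxA (mulmxA U) (mulmxA (U *m N)).
  by rewrite e mul0mx mulmx0.
apply/row_matrixP => i; rewrite row0 !row_mul.
apply: (can_inj (@conjtmxK _ _ _)); rewrite conjtmxM conjtmxK conjtmx0.
apply/row_matrixP => j; rewrite row0 row_mul.
apply: (can_inj (@conjtmxK _ _ _)); rewrite conjtmxM conjtmxK conjtmx0.
by apply: h; apply: row_sub.
Qed.

Section Hermitian.
Variables (n : nat) (N : 'M[C]_n).
Hypothesis hN : hermitian_mx N.

Lemma perpC k l (U : 'M_(k, n)) (V : 'M_(l, n)) :
  (U <= perp N V)%MS = (V <= perp N U)%MS.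
Proof.
rewrite !sub_perp; apply/eqP/eqP => /(congr1 (@conjtmx C _ _));
by rewrite !conjtmxM conjtmxK conjtmx0 hN mulmxA.
Qed.

Lemma rank_perp k (V : 'M_(k, n)) : (\rank (perp N V) + \rank (V *m N) = n)%N.
Proof.
rewrite mxrank_ker -[\rank (V *m N)]rank_conjtmx conjtmxM hN subnK //.
exact: rank_leq_row.
Qed.

Lemma perpS k l (U : 'M_(k, n)) (V : 'M_(l, n)) :
  (U <= V)%MS -> (perp N V <= perp N U)%MS.
Proof. by move=> UV; rewrite perpC; apply: submx_trans UV _; rewrite perpC. Qed.

Lemma kermx_perp k (V : 'M_(k, n)) : (kermx N <= perp N V)%MS.
Proof. by rewrite sub_perp mulmx_ker mul0mx. Qed.

Lemma perp_adds k l (U : 'M_(k, n)) (V : 'M_(l, n)) :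
  (perp N (U + V)%MS :=: perp N U :&: perp N V)%MS.
Proof.
apply/eqmxP/andP; split.
  by rewrite sub_capmx !perpS ?addsmxSl ?addsmxSr.
by rewrite perpC addsmx_sub perpC capmxSl /= perpC capmxSr.
Qed.

(* Modulo the radical [kermx N] the form is nondegenerate. *)
Lemma rank_mul_form k (V : 'M_(k, n)) : (kermx N <= V)%MS ->
  (\rank (V *m N) + \rank (kermx N) = \rank V)%N.
Proof.
move=> kV; rewrite -(mxrank_mul_ker V N); congr (_ + _)%N.
exact/esym/eqmx_rank/eqmxP/capmx_idPr.
Qed.

(** One inclusion is the symmetry of orthogonality. The dimensions agree because both spaces contain
    the radical, so multiplication by [N] lowers each dimension by that of the radical. *)
Lemma perpK k (V : 'M_(k, n)) : (kermx N <= V)%MS -> (perp N (perp N V) :=: V)%MS.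
Proof.
move=> kV; apply/eqmx_sym/eqmxP.
have sub : (V <= perp N (perp N V))%MS by rewrite perpC.
rewrite -(geq_leqif (mxrank_leqif_eq sub)).
have h1 := rank_perp V; have h2 := rank_perp (perp N V).
have h3 := rank_mul_form kV; have h4 := rank_mul_form (kermx_perp V).
move: h1 h2 h3 h4; rank_lia.
Qed.

Lemma sqform_real u : sqform N u \is Num.real.
Proof.
apply/CrealP; have := hermitian_sandwich u hN.
by move/matrixP/(_ 0 0); rewrite /conjtmx 2!mxE.
Qed.

Lemma sqformD (u v : 'rV_n) : u *m N *m v^h = 0 ->
  sqform N (u + v) = sqform N u + sqform N v.
Proof.
move=> e; have e' : v *m N *m u^h = 0 by apply/eqP; rewrite -sub_perp perpC sub_perp e.
by rewrite /sqform conjtmxD mulmxDr !mulmxDl e e' addr0 add0r mxE.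
Qed.

(** The positive eigenspace of the Gram matrix [K *m N *m K^h] is carried into the row space of
    [K]. *)
Lemma pidx_witness k (K : 'M_(k, n)) :
  exists P : 'M_n, [/\ (P <= K)%MS, posdef N P & \rank P = pidx N K].
Proof.
have [P [_ [dP _ rP _]]] := inertia_pos_splitting (hermitian_sandwich K hN).
exists <<P *m K>>%MS; split; first by rewrite genmxE submxMl.
  move=> u; rewrite genmxE => /submxP[x ->]; rewrite mulmxA => nz.
  rewrite sqformE; apply: dP; first exact: submxMl.
  by apply: contraNneq nz => ->; rewrite mul0mx.
rewrite mxrank_gen pidx.unlock -rP -(mxrank_mul_ker P K).
(* No dimension is lost: a vector of [P] killed by [K] would have value 0. *)
suff -> : (P :&: kermx K)%MS = 0 by rewrite mxrank0 addn0.
apply/eqP; rewrite -submx0; apply/rV_subP => u; rewrite sub_capmx => /andP[uP].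
rewrite sub_kermx => /eqP uK; rewrite submx0; apply: contraT => u0.
have := dP _ uP u0; rewrite -sqformE uK sqform0 ltxx //.
Qed.

(** With [pidx_witness], this identifies [pidx N K] as the largest dimension of a positive definite
    subspace. The coordinates [T] of a basis of [P] must be independent of the nonpositive
    eigenspace of the Gram matrix. *)
Lemma pidx_max k l (K : 'M_(k, n)) (P : 'M_(l, n)) :
  (P <= K)%MS -> posdef N P -> (\rank P <= pidx N K)%N.
Proof.
move=> PK dP; have [_ [Q [_ nQ _ rQ]]] := inertia_pos_splitting (hermitian_sandwich K hN).
have /submxP[T eT] : (row_base P <= K)%MS by rewrite eq_row_base.
have dT : posdef (K *m N *m K^h) T.
  move=> u /submxP[x ->] nz; rewrite -sqformE -mulmxA -eT.
  apply: dP; first by rewrite (submx_trans (submxMl _ _)) ?eq_row_base.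
  apply: contraNneq nz => e0.
  have -> : x = 0 by apply: (row_free_inj (row_base_free P)); rewrite mul0mx.
  by rewrite mul0mx.
have rT : (\rank P <= \rank T)%N by rewrite -[leqLHS](eq_row_base P) eT mxrankM_maxl.
have := posdef_nonpos_cap dT nQ.
move: rQ rT; rewrite pidx.unlock; rank_lia.
Qed.

Lemma pidxS k l (K : 'M_(k, n)) (L : 'M_(l, n)) :
  (K <= L)%MS -> (pidx N K <= pidx N L)%N.
Proof.
move=> KL; have [P [PK dP <-]] := pidx_witness K.
by apply: pidx_max dP; apply: submx_trans KL.
Qed.

(** Intersecting a maximal positive definite subspace of [L] with [K] loses at most the codimension
    of [K] in [L]. *)
Lemma pidx_codim k l (K : 'M_(k, n)) (L : 'M_(l, n)) :
  (K <= L)%MS -> (pidx N L + \rank K <= pidx N K + \rank L)%N.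
Proof.
move=> KL; have [P [PL dP <-]] := pidx_witness L.
have := mxrank_sum_cap P K.
have : (\rank (P :&: K) <= pidx N K)%N.
  by apply: pidx_max; [apply: capmxSr | apply: posdefS dP; apply: capmxSl].
have : (\rank (P + K) <= \rank L)%N by rewrite mxrankS // addsmx_sub PL.
rank_lia.
Qed.

(** Take the [K]-components of a maximal positive definite subspace. Dropping the orthogonal
    [G]-component cannot lower the value, so this projection is injective and its image positive
    definite. *)
Lemma pidx_perp_nonpos k l (K : 'M_(k, n)) (G : 'M_(l, n)) :
  (G <= perp N K)%MS -> nonpos N G -> (pidx N (K + G)%MS <= pidx N K)%N.
Proof.
move=> GK nG; have [P [PL dP <-]] := pidx_witness (K + G)%MS.
have /sub_addsmxP[[T1 T2] /= eP] : (row_base P <= K + G)%MS by rewrite eq_row_base.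
have key x : x != 0 -> 0 < sqform N (x *m (T1 *m K)).
  move=> nz; have xP : 0 < sqform N (x *m row_base P).
    apply: dP; first by rewrite (submx_trans (submxMl _ _)) ?eq_row_base.
    apply: contraNneq nz => e0.
    by apply/eqP/(row_free_inj (row_base_free P)); rewrite mul0mx.
  move: xP; rewrite eP mulmxDr sqformD; last first.
    have /mulmx_sum_perp -> // : (K <= perp N G)%MS by rewrite perpC.
      by rewrite mulmxA submxMl.
    by rewrite mulmxA submxMl.
  move/lt_le_trans; apply; rewrite gerDl; apply: nG; by rewrite mulmxA submxMl.
have f : row_free (T1 *m K).
  rewrite -kermx_eq0 -submx0; apply/rV_subP => u.
  rewrite sub_kermx => /eqP e; rewrite submx0; apply: contraT => /key.
  by rewrite e sqform0 ltxx.
have := f; rewrite /row_free => /eqP <-.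
apply: pidx_max; first exact: submxMl.
move=> u /submxP[x ->] nz; apply: key; apply: contraNneq nz => ->.
by rewrite mul0mx.
Qed.

End Hermitian.

Lemma pidx_rank n (N : 'M[C]_n) k (K : 'M_(k, n)) : hermitian_mx N ->
  \rank (K *m N *m K^h) = (pidx N K + pidx (- N) K)%N.
Proof.
move=> hN; have hK := hermitian_sandwich K hN.
by rewrite (rank_inertia hK) (inertia_negE hK) pidx.unlock mulmxN mulNmx.
Qed.

Lemma sub_perp_opp n (N : 'M[C]_n) k l (U : 'M_(k, n)) (V : 'M_(l, n)) :
  (U <= perp (- N) V)%MS = (U <= perp N V)%MS.
Proof. by rewrite !sub_perp mulmxN mulNmx oppr_eq0. Qed.

(* Both inertias drop by at most the codimension of [L :&: Z^perp] in [L], while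
   the rank drops by at least twice that. *)
Lemma pidx_isotropic n (N : 'M[C]_n) k l (Z : 'M_(k, n)) (L : 'M_(l, n)) :
  hermitian_mx N -> (Z <= L)%MS -> (Z <= perp N Z)%MS ->
  (pidx N (L :&: perp N Z)%MS + \rank (Z *m N *m L^h) <= pidx N L)%N.
Proof.
move=> hN ZL ZZ; set L' := (L :&: perp N Z)%MS.
have L'L : (L' <= L)%MS by apply: capmxSl.
have ZL' : (Z <= L')%MS by rewrite sub_capmx ZL.
have hN' := hermitian_opp hN.
have c := pidx_codim hN' L'L.
have rL := rank_form N L L; have rL' := rank_form N L' L'.
have rLZ := rank_form N L Z; have rZL := rank_form N Z L.
rewrite -/L' in rLZ.
have e : \rank (L *m N *m Z^h) = \rank (Z *m N *m L^h).
  by rewrite -rank_conjtmx !conjtmxM conjtmxK hN mulmxA.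
rewrite (pidx_rank _ hN) in rL; rewrite (pidx_rank _ hN) in rL'.
(* The radical of [L'] contains [Z] as well as the radical of [L]; this gives the second half of the
   rank drop, the first being the codimension itself. *)
have s1 : (\rank (Z + (L :&: perp N L))%MS <= \rank (L' :&: perp N L'))%N.
  apply: mxrankS; rewrite addsmx_sub !sub_capmx ZL ZZ capmxSl /=.
  rewrite (perpC hN Z) capmxSr /= (submx_trans (capmxSr _ _)) ?perpS //=.
  by rewrite (submx_trans (capmxSr _ _)) ?perpS.
have s2 : (\rank (Z :&: (L :&: perp N L)) <= \rank (Z :&: perp N L))%N.
  by apply: mxrankS; rewrite sub_capmx capmxSl (submx_trans (capmxSr _ _)) ?capmxSr.
have s3 := mxrank_sum_cap Z (L :&: perp N L)%MS.
move: c rL rL' rLZ rZL e s1 s2 s3; rank_lia.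
Qed.

End Index.

(** * Bounds valid for every complement *)

Section Bounds.
Variables (C : numClosedFieldType) (n : nat) (N : 'M[C]_n).
Hypothesis hN : hermitian_mx N.
Variables (k f l : nat) (K : 'M[C]_(k, n)) (F : 'M[C]_(f, n)) (L : 'M[C]_(l, n)).
Hypotheses (KL : (K <= L)%MS) (LF : (1%:M <= L + F)%MS).

(** [Z] is isotropic and orthogonal to [F], so its part orthogonal to [L] is orthogonal to
    everything and lies in [kermx N]. The remaining dimensions of [Z] pair with [L] and are gained
    by [pidx_isotropic]. *)
Lemma pidx_ge_sub :
  (pidx N K + \rank (K *m N) <= pidx N L + \rank (K *m N *m (K + F)%MS^h))%N.
Proof.
set Z := (K :&: perp N (K + F)%MS)%MS.
have ZK : (Z <= K)%MS by apply: capmxSl.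
have Zp : (Z <= perp N (K + F)%MS)%MS by apply: capmxSr.
have ZZ : (Z <= perp N Z)%MS.
  by apply: submx_trans Zp _; apply: perpS => //; rewrite (submx_trans ZK) ?addsmxSl.
have := pidx_isotropic hN (submx_trans ZK KL) ZZ.
have KLZ : (K <= L :&: perp N Z)%MS.
  by rewrite sub_capmx KL perpC // (submx_trans Zp) // perpS ?addsmxSl.
have := pidxS hN KLZ.
have := rank_form N Z L; have := rank_form N K (K + F)%MS; have := mxrank_mul_ker K N.
rewrite -/Z.
suff : (\rank (Z :&: perp N L) <= \rank (K :&: kermx N))%N by rank_lia.
apply: mxrankS; rewrite sub_capmx (submx_trans (capmxSl _ _)) //=.
rewrite -sub_perp1 perpC // (submx_trans LF) // addsmx_sub !(perpC hN _ (Z :&: perp N L)%MS).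
rewrite capmxSr (submx_trans (capmxSl _ _)) //.
by rewrite (submx_trans Zp) // perpS ?addsmxSr.
Qed.

(** Adding the radical to [L] does not raise its index, and leaves codimension
    [\rank N - \rank (L *m N)]. This is bounded because [L *m N] and [(K + F) *m N] together span
    the rows of [N] and share [K *m N]. *)
Lemma pidx_ge_full :
  (pidx N (1%:M : 'M_n) + \rank (K *m N) <= pidx N L + \rank ((K + F)%MS *m N))%N.
Proof.
set M := (L + kermx N)%MS.
have p1 : (pidx N M <= pidx N L)%N.
  apply: pidx_perp_nonpos => //; first exact: kermx_perp.
  by move=> u; rewrite sub_kermx /sqform => /eqP->; rewrite mul0mx mxE.
have p2 := pidx_codim hN (submx1 M).
have p3 : (\rank (M *m N) + \rank (kermx N) = \rank M)%N.
  by apply: rank_mul_form; rewrite addsmxSr.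
have p4 : \rank (M *m N) = \rank (L *m N).
  by rewrite addsmxMr mulmx_ker addsmx0.
have p5 := mxrank_sum_cap (L *m N) ((K + F)%MS *m N).
have p6 : (\rank (K *m N) <= \rank (L *m N :&: (K + F)%MS *m N))%N.
  by apply: mxrankS; rewrite sub_capmx !submxMr // addsmxSl.
have p7 : (\rank N <= \rank (L *m N + (K + F)%MS *m N))%N.
  apply: mxrankS; rewrite -addsmxMr -[X in (X <= _)%MS]mul1mx submxMr //.
  by rewrite (submx_trans LF) // addsmxS // addsmxSr.
have p8 := mxrank_ker N; have p9 := rank_leq_row N.
rewrite mxrank1 in p2.
move: p1 p2 p3 p4 p5 p6 p7 p8 p9; rank_lia.
Qed.

End Bounds.

Lemma rank_form_le (C : numClosedFieldType) n (N : 'M[C]_n) k l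
    (K : 'M_(k, n)) (L : 'M_(l, n)) : (K <= L)%MS ->
  (\rank (L *m N *m L^h) + \rank K <= \rank (K *m N) + \rank L)%N.
Proof.
move=> KL; have p1 := mxrankM_maxl (L *m N) L^h.
have p2 := mxrank_mul_ker L N; have p3 := mxrank_mul_ker K N.
have p4 : (\rank (K :&: kermx N) <= \rank (L :&: kermx N))%N by rewrite mxrankS ?capmxS.
move: p1 p2 p3 p4; rank_lia.
Qed.

(** * Vectors avoiding several proper subspaces *)

Section Avoid.
Variables (C : numClosedFieldType) (n : nat).

Lemma avoid1 g s (G : 'M[C]_(g, n)) (S : 'M[C]_(s, n)) :
  ~~ (G <= S)%MS -> exists2 v : 'rV_n, (v <= G)%MS & ~~ (v <= S)%MS.
Proof. by move=> /row_subPn[i h]; exists (row i G) => //; apply: row_sub. Qed.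

Lemma avoid2 g s t (G : 'M[C]_(g, n)) (S : 'M[C]_(s, n)) (T : 'M[C]_(t, n)) :
  ~~ (G <= S)%MS -> ~~ (G <= T)%MS ->
  exists v : 'rV_n, [/\ (v <= G)%MS, ~~ (v <= S)%MS & ~~ (v <= T)%MS].
Proof.
move=> /avoid1[v vG vS] /avoid1[w wG wT].
case: (boolP (v <= T)%MS) => vT; last by exists v.
case: (boolP (w <= S)%MS) => wS; last by exists w.
exists (v + w); split; first exact: addmx_sub.
  by apply: contra vS => h; rewrite -(addrK w v); apply: addmx_sub; rewrite ?eqmx_opp.
by apply: contra wT => h; rewrite -(addKr v w); apply: addmx_sub; rewrite ?eqmx_opp.
Qed.

Lemma line_sub s (S : 'M[C]_(s, n)) (v w : 'rV_n) a b : a != b ->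
  ((w + a *: v)%R <= S)%MS -> ((w + b *: v)%R <= S)%MS -> (v <= S)%MS && (w <= S)%MS.
Proof.
move=> ab ha hb; have vS : (v <= S)%MS.
  have : (((w + a *: v) - (w + b *: v))%R <= S)%MS by apply: addmx_sub; rewrite ?eqmx_opp.
  rewrite opprD addrACA subrr add0r -scalerBl => h.
  by rewrite -[v](scalerK (a := a - b)) ?subr_eq0 //; apply: scalemx_sub.
rewrite vS -(addrK (a *: v) w).
by apply: addmx_sub; rewrite ?eqmx_opp //; apply: scalemx_sub.
Qed.

(* A line not contained in a subspace meets it at most once, so one of three
   points avoids two subspaces. *)
Lemma line_avoid2 s t (S : 'M[C]_(s, n)) (T : 'M[C]_(t, n)) (v w : 'rV_n) a b c :
  ~~ ((v <= S)%MS && (w <= S)%MS) -> ~~ ((v <= T)%MS && (w <= T)%MS) ->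
  a != b -> a != c -> b != c ->
  exists2 x, x \in [:: a; b; c] &
    ~~ ((w + x *: v)%R <= S)%MS && ~~ ((w + x *: v)%R <= T)%MS.
Proof.
move=> vS vT ab ac bc.
pose good x := ~~ ((w + x *: v)%R <= S)%MS && ~~ ((w + x *: v)%R <= T)%MS.
case: (boolP (good a)) => ga; first by exists a; rewrite ?mem_head.
case: (boolP (good b)) => gb; first by exists b; rewrite ?inE ?eqxx ?orbT.
case: (boolP (good c)) => gc; first by exists c; rewrite ?inE ?eqxx ?orbT.
have oS x y : x != y -> ((w + x *: v)%R <= S)%MS -> ~~ ((w + y *: v)%R <= S)%MS.
  by move=> xy h; apply: contra vS; apply: line_sub xy h.
have oT x y : x != y -> ((w + x *: v)%R <= T)%MS -> ~~ ((w + y *: v)%R <= T)%MS.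
  by move=> xy h; apply: contra vT; apply: line_sub xy h.
move: ga gb gc (oS _ _ ab) (oS _ _ ac) (oS _ _ bc) (oT _ _ ab) (oT _ _ ac) (oT _ _ bc).
rewrite /good !negb_and !negbK.
by do 3 case: (_ <= S)%MS => //=; do ?[case: (_ <= T)%MS => //=]; move=> *; exfalso; eauto.
Qed.

Lemma avoid3 g s t r (G : 'M[C]_(g, n)) (S : 'M[C]_(s, n)) (T : 'M[C]_(t, n))
    (R : 'M[C]_(r, n)) :
  ~~ (G <= S)%MS -> ~~ (G <= T)%MS -> ~~ (G <= R)%MS ->
  exists v : 'rV_n, [/\ (v <= G)%MS, ~~ (v <= S)%MS, ~~ (v <= T)%MS & ~~ (v <= R)%MS].
Proof.
move=> GS GT /avoid1[w wG wR]; have [v [vG vS vT]] := avoid2 GS GT.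
case: (boolP (v <= R)%MS) => vR; last by exists v.
(* The direction [v] lies in [R] and [w] does not, so the whole line avoids [R]; three distinct
   points on it suffice for [S] and [T]. *)
have := @line_avoid2 _ _ S T v w 0 1 (-1).
rewrite (negbTE vS) (negbTE vT) eq_sym oner_eq0 eq_sym oppr_eq0 oner_eq0 -subr_eq0 opprK.
rewrite (_ : 1 + 1 = 2%:R) // pnatr_eq0 => -[] // x _ /andP[hS hT].
exists (w + x *: v); split => //.
  by apply: addmx_sub => //; apply: scalemx_sub.
apply: contra wR => h; rewrite -(addrK (x *: v) w).
by apply: addmx_sub; rewrite ?eqmx_opp //; apply: scalemx_sub.
Qed.

Lemma rank_adds_rV g (G : 'M[C]_(g, n)) (v : 'rV_n) :
  ~~ (v <= G)%MS -> \rank (G + v)%MS = (\rank G).+1.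
Proof.
move=> vG; have := mxrank_sum_cap G v.
have -> : (G :&: v)%MS = 0.
  apply/eqP; rewrite -submx0; apply/rV_subP => u; rewrite sub_capmx => /andP[uG].
  move=> /sub_rVP[a e]; rewrite submx0; apply: contraNT vG => u0.
  have a0 : a != 0 by apply: contraNneq u0 => a0; rewrite e a0 scale0r.
  by rewrite -(scalerK a0 v) -e; apply: scalemx_sub.
rewrite mxrank0 rank_rV; case: eqP => [v0|_]; last by rank_lia.
by rewrite v0 sub0mx in vG.
Qed.

Lemma addsmx_rVP g (G : 'M[C]_(g, n)) (v u : 'rV_n) :
  (u <= G + v)%MS -> exists2 w : 'rV_n, (w <= G)%MS & exists a, u = w + a *: v.
Proof.
move=> /sub_addsmxP[[x y] /= ->]; exists (x *m G); first exact: submxMl.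
by exists (y 0 0); rewrite [y]mx11_scalar mul_scalar_mx mxE eqxx mulr1n.
Qed.

Lemma addsmx_rot a b c (A : 'M[C]_(a, n)) (B : 'M[C]_(b, n)) (D : 'M[C]_(c, n)) :
  (A + B + D :=: A + D + B)%MS.
Proof. by rewrite -addsmxA (addsmxC B) addsmxA. Qed.

End Avoid.

(** * Attaining the maxima *)

Section Steps.
Variables (C : numClosedFieldType) (n : nat).
Implicit Types N K F G : 'M[C]_n.

Lemma sqformZ N a (u : 'rV_n) : sqform N (a *: u) = `|a| ^+ 2 * sqform N u.
Proof.
by rewrite /sqform conjtmxZ -!(scalemxAl, scalemxAr) scalerA mxE normCK.
Qed.

Lemma orthogonalize N (u w : 'rV_n) : sqform N u != 0 ->
  exists c, (w - c *: u) *m N *m u^h = 0.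
Proof.
move=> u0; exists ((w *m N *m u^h) 0 0 / sqform N u).
apply/matrixP => i j; rewrite !ord1 !mulmxBl -!scalemxAl.
by rewrite [LHS]mxE [X in _ + X]mxE [X in _ - X]mxE -/(sqform N u) divfK // subrr [RHS]mxE.
Qed.

Lemma posdef_complement N k (P : 'M_(k, n)) : hermitian_mx N -> posdef N P ->
  (1%:M <= P + perp N P)%MS.
Proof.
move=> hN dP.
have c0 : (P :&: perp N P)%MS = 0.
  apply/eqP; rewrite -submx0; apply/rV_subP => u; rewrite sub_capmx => /andP[uP up].
  rewrite submx0; apply: contraT => u0; have := dP _ uP u0.
  by have /mulmx_sum_perp e := up; rewrite /sqform e // mxE ltxx.
have := mxrank_sum_cap P (perp N P); rewrite c0 mxrank0 addn0 => e.
rewrite sub1mx -col_leq_rank e; have := rank_perp hN P; have := mxrankM_maxl P N.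
rank_lia.
Qed.

Lemma posdef_adds N k (P : 'M_(k, n)) (v : 'rV_n) : hermitian_mx N -> posdef N P ->
  (v <= perp N P)%MS -> 0 < sqform N v -> posdef N (P + v)%MS /\ ~~ (v <= P)%MS.
Proof.
move=> hN dP vP v0; have ort := mulmx_sum_perp _ _ _ vP; split.
  move=> u /addsmx_rVP[w wP [a ->]] nz.
  rewrite sqformD //; last first.
    have /mulmx_sum_perp -> // : (P <= perp N v)%MS by rewrite perpC.
    by rewrite scalemx_sub.
  rewrite sqformZ; case: (eqVneq w 0) => [w0|w0].
    rewrite w0 sqform0 add0r mulr_gt0 // exprn_gt0 // normr_gt0.
    by apply: contraNneq nz => ->; rewrite w0 scale0r addr0.
  by rewrite ltr_wpDr ?dP // mulr_ge0 ?exprn_ge0 // ltW.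
apply: contraTN v0 => /(ort v _ (submx_refl _)) e.
by rewrite /sqform e mxE ltxx.
Qed.

(** Let [P] be maximal positive definite in [K]. By dimension, [perp N P] contains a positive vector
    [u]. If [u] lies in [K + F], a vector of [perp N P] outside [K + F] is made orthogonal to [u]
    and shifted by a large multiple of [u]. *)
Lemma pidx_step N K F : hermitian_mx N ->
  (pidx N K < pidx N (1%:M : 'M_n))%N -> ~~ (1%:M <= K + F)%MS ->
  exists2 v : 'rV_n, ~~ (v <= K + F)%MS & (pidx N K < pidx N (K + v)%MS)%N.
Proof.
move=> hN lt KF.
have [P [PK dP rP]] := pidx_witness hN K.
have [P' [_ dP' rP']] := pidx_witness hN (1%:M : 'M_n).
suff [v [vKF vP v0]] : exists v : 'rV_n,
    [/\ ~~ (v <= K + F)%MS, (v <= perp N P)%MS & 0 < sqform N v].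
  exists v; [exact: vKF|]; have [dPv vnP] := posdef_adds hN dP vP v0.
  by rewrite -rP -(rank_adds_rV vnP); apply: pidx_max => //; apply: addsmxS.
have cap0 : (P' :&: perp N P)%MS != 0.
  rewrite -mxrank_eq0; have := mxrank_sum_cap P' (perp N P).
  have := rank_perp hN P; have := mxrankM_maxl P N.
  have := rank_leq_col (P' + perp N P)%MS; rewrite -rP -rP' in lt; move: lt; rank_lia.
have /rowV0Pn[u] := cap0; rewrite sub_capmx => /andP[uP' uP] u0.
have {}u0 := dP' _ uP' u0.
case: (boolP (u <= K + F)%MS) => uKF; last by exists u.
have [w wP wKF] : exists2 w : 'rV_n, (w <= perp N P)%MS & ~~ (w <= K + F)%MS.
  apply: avoid1; apply: contra KF => h.
  apply: submx_trans (posdef_complement hN dP) _.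
  by rewrite addsmx_sub h (submx_trans PK) ?addsmxSl.
have [c ort] := orthogonalize w (lt0r_neq0 u0).
set w' := w - c *: u in ort.
have w'P : (w' <= perp N P)%MS.
  by apply: addmx_sub; rewrite ?eqmx_opp //; apply: scalemx_sub.
have w'KF : ~~ (w' <= K + F)%MS.
  apply: contra wKF => h; rewrite -(subrK (c *: u) w).
  by apply: addmx_sub => //; apply: scalemx_sub.
(* Since [s >= 1], [s ^+ 2] dominates [s], and [s * sqform N u] already exceeds the absolute value
   at [w'] by [sqform N u]. *)
pose s := 1 + `|sqform N w'| / sqform N u.
have ss : s * sqform N u = sqform N u + `|sqform N w'|.
  by rewrite mulrDl mul1r divfK // gt_eqF.
have s1 : 1 <= s by rewrite lerDl divr_ge0 // ltW.
exists (w' + s *: u); split.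
- apply: contra w'KF => h; rewrite -(addrK (s *: u) w').
  by apply: addmx_sub; rewrite ?eqmx_opp //; apply: scalemx_sub.
- by apply: addmx_sub => //; apply: scalemx_sub.
rewrite sqformD //; last by rewrite conjtmxZ -scalemxAr ort scaler0.
rewrite sqformZ ger0_norm ?(le_trans ler01) //.
have le1 : s * sqform N u <= s ^+ 2 * sqform N u.
  by rewrite ler_pM2r // expr2 ler_peMl // (le_trans ler01).
apply: lt_le_trans (_ : sqform N w' + s * sqform N u <= _); last by rewrite lerD2l.
rewrite ss addrCA ltr_pwDl //.
by case: (real_ge0P (sqform_real hN w')) => h; [apply: addr_ge0 | rewrite subrr].
Qed.

(** [v] forms a hyperbolic pair with a vector of the radical of [K]. Used for [N] and for [- N],
    this raises the rank by two. *)
Lemma pidx_jump N K k (Z : 'M_(k, n)) (v : 'rV_n) : hermitian_mx N ->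
  (Z <= K)%MS -> (Z <= perp N K)%MS -> ~~ (v <= perp N Z)%MS ->
  (pidx N K < pidx N (K + v)%MS)%N.
Proof.
move=> hN ZK Zp vZ.
have ZZ : (Z <= perp N Z)%MS by apply: submx_trans Zp _; apply: perpS.
have := pidx_isotropic hN (submx_trans ZK (addsmxSl K v)) ZZ.
have : (pidx N K <= pidx N ((K + v)%MS :&: perp N Z)%MS)%N.
  by apply: pidxS => //; rewrite sub_capmx addsmxSl perpC.
have : (0 < \rank (Z *m N *m (K + v)%MS^h))%N.
  rewrite lt0n mxrank_eq0 -sub_perp; apply: contra vZ => h.
  by rewrite perpC // (submx_trans h) // perpS // addsmxSr.
rank_lia.
Qed.

(** Induction on the codimension of [K + F]: each added vector raises the index by one until it is
    full, and afterwards any vector outside [K + F] will do. The rank equation lets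
    [graph_exists_eq] place [L] inside a graph. *)
Lemma max_pidx_exists N K F : hermitian_mx N -> exists L : 'M[C]_n,
  [/\ (K <= L)%MS, (1%:M <= L + F)%MS,
    (\rank L + \rank (K + F)%MS = \rank K + n)%N &
    (minn (n - \rank (K + F)%MS + pidx N K) (pidx N (1%:M : 'M_n)) <= pidx N L)%N].
Proof.
move=> hN; move e : (n - \rank (K + F)%MS)%N => a; elim: a K e => [|a IH] K e.
  have r : (\rank (K + F)%MS = n)%N.
    by apply/eqP; rewrite eqn_leq rank_leq_col /= -subn_eq0 e.
  exists K; split; rewrite ?r //; last by rewrite add0n geq_minl.
  by rewrite sub1mx -col_leq_rank r.
have KF : ~~ (1%:M <= K + F)%MS by rewrite sub1mx -col_leq_rank -subn_eq0 e.
have [v vKF step] : exists2 v : 'rV_n, ~~ (v <= K + F)%MS &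
    (minn (pidx N K).+1 (pidx N (1%:M : 'M_n)) <= pidx N (K + v)%MS)%N.
  case: (ltnP (pidx N K) (pidx N (1%:M : 'M_n))) => lt.
    have [v v1 v2] := pidx_step hN lt KF; exists v => //.
    by rewrite (leq_trans (geq_minl _ _)).
  have [v _ v1] := avoid1 KF; exists v => //.
  rewrite (leq_trans (geq_minr _ _)) // (leq_trans lt) //.
  by apply: pidxS => //; apply: addsmxSl.
have rF : \rank (K + v + F)%MS = (\rank (K + F)%MS).+1.
  by rewrite addsmx_rot rank_adds_rV.
have rK : \rank (K + v)%MS = (\rank K).+1.
  by rewrite rank_adds_rV //; apply: contra vKF => h; rewrite (submx_trans h) ?addsmxSl.
have [|L [KL LF rL pL]] := IH (K + v)%MS; first by rewrite rF subnS e.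
exists L; split => //.
- by rewrite (submx_trans _ KL) ?addsmxSl.
- by move: rL; rewrite rF rK; rank_lia.
- by move: pL step; rank_lia.
Qed.

(** With [a] the codimension of [K + F], each of the three outcomes keeps the minimum of [a + rho],
    [2a + r] and [\rank N] from falling when [a] drops by one. *)
Lemma rank_step N K F : hermitian_mx N -> ~~ (1%:M <= K + F)%MS ->
  let r := \rank (K *m N *m K^h) in let rho := \rank (K *m N) in
  exists2 v : 'rV_n, ~~ (v <= K + F)%MS &
  let K' := (K + v)%MS in
  let r' := \rank (K' *m N *m K'^h) in let rho' := \rank (K' *m N) in
  [\/ (r.+2 <= r')%N /\ (minn rho.+1 (\rank N) <= rho')%N,
      [/\ r = rho, (r < r')%N & (rho < rho')%N] | (\rank N <= r')%N].
Proof.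
move=> hN KF r rho; have hN' := hermitian_opp hN.
have rhoE := mxrank_mul_ker K N; have rE := rank_form N K K.
rewrite -/r in rE; rewrite -/rho in rhoE.
have kp : (\rank (K :&: kermx N) <= \rank (K :&: perp N K))%N.
  by apply: mxrankS; apply: capmxS => //; apply: kermx_perp.
have [lt|ge] := ltnP r rho.
  set Z := (K :&: perp N K)%MS in rE.
  (* [r < rho] means that the radical [Z] of [K] is larger than [K :&: kermx N], so some vector
     pairs nontrivially with it. *)
  have Z1 : ~~ (1%:M <= perp N Z)%MS.
    apply: contraL lt => h; rewrite -leqNgt.
    have : (\rank Z <= \rank (K :&: kermx N))%N.
      by apply: mxrankS; rewrite sub_capmx capmxSl -sub_perp1 perpC.
    by move: rE rhoE; rank_lia.
  have jump (v : 'rV_n) : ~~ (v <= perp N Z)%MS ->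
      (r.+2 <= \rank ((K + v)%MS *m N *m (K + v)%MS^h))%N.
    move=> vZ; rewrite /r !pidx_rank //.
    have := pidx_jump hN (capmxSl _ _) (capmxSr _ _) vZ.
    have vZ' : ~~ (v <= perp (- N) Z)%MS by rewrite sub_perp_opp.
    have Zp : (Z <= perp (- N) K)%MS by rewrite sub_perp_opp capmxSr.
    by have := pidx_jump hN' (capmxSl _ _) Zp vZ'; rank_lia.
  (* If [K + kermx N] is everything, [rho] is already [\rank N]; otherwise [v] is also taken outside
     it, so that [rho] grows. *)
  case: (boolP (1%:M <= K + kermx N)%MS) => Kk.
    have [v [_ v1 v2]] := avoid2 KF Z1; exists v => //=.
    constructor 1; split; first exact: jump.
    rewrite (leq_trans (geq_minr _ _)) //.
    have -> : \rank N = \rank (1%:M *m N) by rewrite mul1mx.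
    apply: (@leq_trans (\rank ((K + kermx N)%MS *m N))); first by rewrite mxrankS ?submxMr.
    by rewrite addsmxMr mulmx_ker addsmx0 mxrankS ?submxMr ?addsmxSl.
  have [v [_ v1 v2 v3]] := avoid3 KF Z1 Kk; exists v => //=.
  constructor 1; split; first exact: jump.
  rewrite (leq_trans (geq_minl _ _)) //.
  have := mxrank_mul_ker (K + v)%MS N; have := mxrank_sum_cap (K + v)%MS (kermx N).
  have := mxrank_sum_cap K (kermx N).
  rewrite addsmx_rot (rank_adds_rV v3) rank_adds_rV; first by move: rhoE; rank_lia.
  by apply: contra v3 => h; rewrite (submx_trans h) ?addsmxSl.
have er : r = rho by move: rE rhoE kp ge; rank_lia.
have [lt2|ge2] := ltnP r (\rank N); last first.
  have [v _ v1] := avoid1 KF; exists v => //=; constructor 3; apply: leq_trans ge2 _.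
  by rewrite /r !pidx_rank //; apply: leq_add; apply: pidxS => //; apply: addsmxSl.
have N1 := pidx_rank (1%:M : 'M_n) hN; rewrite mul1mx conjtmx1 mulmx1 in N1.
(* As [r < \rank N], one of the two indices is not yet full; [pidx_step] raises it while the other
   cannot fall. *)
have [v v1 v2] : exists2 v : 'rV_n, ~~ (v <= K + F)%MS &
    (r < \rank ((K + v)%MS *m N *m (K + v)%MS^h))%N.
  have [lt3|ge3] := ltnP (pidx N K) (pidx N (1%:M : 'M_n)).
    have [v v1 v2] := pidx_step hN lt3 KF; exists v => //.
    have := pidxS hN' (addsmxSl K v); rewrite /r !pidx_rank //; move: v2; rank_lia.
  have lt4 : (pidx (- N) K < pidx (- N) (1%:M : 'M_n))%N.
    by move: lt2 ge3 N1; rewrite /r pidx_rank //; rank_lia.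
  have [v v1 v2] := pidx_step hN' lt4 KF; exists v => //.
  have := pidxS hN (addsmxSl K v); rewrite /r !pidx_rank //; move: v2; rank_lia.
exists v => //=; constructor 2; split => //.
by rewrite -er (leq_trans v2) // mxrankM_maxl.
Qed.

Lemma max_rank_exists N K F : hermitian_mx N -> exists L : 'M[C]_n,
  [/\ (K <= L)%MS, (1%:M <= L + F)%MS,
    (\rank L + \rank (K + F)%MS = \rank K + n)%N &
    (minn (n - \rank (K + F)%MS + \rank (K *m N))
       (minn (2 * (n - \rank (K + F)%MS) + \rank (K *m N *m K^h)) (\rank N))
       <= \rank (L *m N *m L^h))%N].
Proof.
move=> hN; move e : (n - \rank (K + F)%MS)%N => a; elim: a K e => [|a IH] K e.
  have r : (\rank (K + F)%MS = n)%N.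
    by apply/eqP; rewrite eqn_leq rank_leq_col /= -subn_eq0 e.
  exists K; split; rewrite ?r //; last by rank_lia.
  by rewrite sub1mx -col_leq_rank r.
have KF : ~~ (1%:M <= K + F)%MS by rewrite sub1mx -col_leq_rank -subn_eq0 e.
have [v vKF /= step] := rank_step hN KF.
have rF : \rank (K + v + F)%MS = (\rank (K + F)%MS).+1.
  by rewrite addsmx_rot rank_adds_rV.
have rK : \rank (K + v)%MS = (\rank K).+1.
  by rewrite rank_adds_rV //; apply: contra vKF => h; rewrite (submx_trans h) ?addsmxSl.
have [|L [KL LF rL pL]] := IH (K + v)%MS; first by rewrite rF subnS e.
exists L; split => //.
- by rewrite (submx_trans _ KL) ?addsmxSl.
- by move: rL; rewrite rF rK; rank_lia.
have p1 := mxrankM_maxl (K *m N) K^h.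
have p2 := mxrankM_maxl ((K + v)%MS *m N) (K + v)%MS^h.
have p3 := mxrankM_maxr K N.
by case: step => [[s1 s2]|[s1 s2 s3]|s1]; move: p1 p2 p3 pL;
  [move: s1 s2|move: s1 s2 s3|move: s1]; rank_lia.
Qed.

End Steps.

(** * Attaining the minima *)

Section Minimum.
Variables (C : numClosedFieldType) (n : nat).
Implicit Types N M K F G L S T : 'M[C]_n.

(* [w] avoids [S] and [T], so no line through [w] lies in either; the line
   through [w] and a negative vector orthogonal to [w] has many isotropic points. *)
Lemma isotropic_avoid2_pos N G S T (w q : 'rV_n) : hermitian_mx N ->
  (w <= G)%MS -> ~~ (w <= S)%MS -> ~~ (w <= T)%MS -> 0 < sqform N w ->
  (q <= G)%MS -> sqform N q < 0 ->
  exists v : 'rV_n, [/\ (v <= G)%MS, ~~ (v <= S)%MS, ~~ (v <= T)%MS & sqform N v = 0].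
Proof.
move=> hN wG wS wT w0 qG q0.
have [c ort] := orthogonalize q (lt0r_neq0 w0); set q' := q - c *: w in ort.
have q'G : (q' <= G)%MS by apply: addmx_sub; rewrite ?eqmx_opp //; apply: scalemx_sub.
have q'0 : sqform N q' < 0.
  apply: le_lt_trans q0.
  have -> : sqform N q = sqform N q' + `|c| ^+ 2 * sqform N w.
    rewrite -sqformZ -sqformD ?subrK //.
    by rewrite conjtmxZ -scalemxAr ort scaler0.
  by rewrite lerDl mulr_ge0 ?exprn_ge0 // ltW.
have ratio : 0 < sqform N w / - sqform N q' by rewrite divr_gt0 ?oppr_gt0.
(* [w] and [q'] are orthogonal with values of opposite sign, so [w + x *: q'] is isotropic as soon
   as [x] has modulus [s]. *)
pose s := sqrtC (sqform N w / - sqform N q').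
have s0 : 0 < s by rewrite sqrtC_gt0.
have iso x : `|x| = s -> sqform N (w + x *: q') = 0.
  move=> xs; rewrite addrC sqformD //; last by rewrite -!scalemxAl ort scaler0.
  rewrite sqformZ xs sqrtCK invrN mulrN mulNr divfK ?addNr //.
  by rewrite lt_eqF.
have sn0 : s != 0 by rewrite gt_eqF.
have neq_i (x : C) : x ^+ 2 = 1 -> x != 'i.
  move=> x1; apply: contra_eq_neq x1 => ->.
  by rewrite sqrCi eq_sym -addr_eq0 -[_ + _]/(2%:R) pnatr_eq0.
(* Three distinct numbers of modulus [s], as [line_avoid2] requires. *)
have [|||||x xs /andP[hS hT]] := @line_avoid2 _ _ _ _ S T q' w s (- s) (s * 'i).
- by rewrite negb_and wS orbT.
- by rewrite negb_and wT orbT.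
- by rewrite -subr_eq0 opprK -mulr2n mulrn_eq0 /= gt_eqF.
- by rewrite -{1}[s]mulr1 (inj_eq (mulfI sn0)) neq_i ?expr1n.
- by rewrite -mulrN1 (inj_eq (mulfI sn0)) neq_i ?sqrrN ?expr1n.
exists (w + x *: q'); split => //.
  by apply: addmx_sub => //; apply: scalemx_sub.
apply: iso; move: xs; rewrite !inE => /or3P[] /eqP->;
by rewrite ?normrN ?normrM ?normCi ?mulr1 gtr0_norm.
Qed.

(** If the form takes both signs on [G], a vector avoiding [S] and [T] is either isotropic or can be
    combined with a vector of the opposite sign. *)
Lemma isotropic_avoid2 N G S T : hermitian_mx N ->
  ~~ (G <= S)%MS -> ~~ (G <= T)%MS ->
  [\/ nonpos N G, nonpos (- N) G | exists v : 'rV_n,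
    [/\ (v <= G)%MS, ~~ (v <= S)%MS, ~~ (v <= T)%MS & sqform N v = 0]].
Proof.
move=> hN GS GT; have hN' := hermitian_opp hN.
have neg M : hermitian_mx M -> (0 < pidx M G)%N -> exists2 u : 'rV_n, (u <= G)%MS & 0 < sqform M u.
  move=> hM; have [P [PG dP <-]] := pidx_witness hM G.
  rewrite lt0n mxrank_eq0 => /rowV0Pn[u uP u0]; exists u; last exact: dP.
  exact: submx_trans PG.
have nonp M : hermitian_mx M -> pidx M G = 0%N -> nonpos M G.
  move=> hM p0 u uG; rewrite real_leNgt ?sqform_real ?real0 //; apply/negP => u0.
  have uP : posdef M u.
    move=> _ /sub_rVP[a ->] nz; rewrite sqformZ mulr_gt0 // exprn_gt0 // normr_gt0.
    by apply: contraNneq nz => ->; rewrite scale0r.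
  have := pidx_max hM uG uP; rewrite p0 leqn0 mxrank_eq0 => /eqP e.
  by rewrite e sqform0 ltxx in u0.
case: (posnP (pidx N G)) => [/nonp-/(_ hN)|]; first by constructor 1.
move=> /(neg _ hN)[p pG p0].
case: (posnP (pidx (- N) G)) => [/nonp-/(_ hN')|]; first by constructor 2.
move=> /(neg _ hN')[q qG]; rewrite sqformN oppr_gt0 => q0.
constructor 3; have [w [wG wS wT]] := avoid2 GS GT.
case: (real_ltgt0P (sqform_real hN w)) => w0.
- exact: isotropic_avoid2_pos wG wS wT w0 qG q0.
- have [||v [vG vS vT v0]] := isotropic_avoid2_pos hN' wG wS wT _ pG.
  + by rewrite sqformN oppr_gt0.
  + by rewrite sqformN oppr_lt0.
  by exists v; split => //; apply/eqP; rewrite -oppr_eq0 -sqformN v0.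
- by exists w; split.
Qed.

(** By double orthogonality the complement of the sum is [K :&: perp N (K + F)], which is no larger
    than the radical. *)
Lemma perp_complement_full N K F : hermitian_mx N -> (kermx N <= K)%MS ->
  (\rank (K :&: perp N (K + F)%MS) <= \rank (kermx N))%N ->
  (1%:M <= perp N K + (K + F)%MS)%MS.
Proof.
move=> hN kK r; set S := (_ + _)%MS.
have kS : (kermx N <= S)%MS by apply: submx_trans (kermx_perp N K) (addsmxSl _ _).
have : (\rank (perp N S) <= \rank (kermx N))%N.
  apply: leq_trans r; apply: mxrankS; rewrite perp_adds // sub_capmx capmxSr andbT.
  by rewrite (submx_trans (capmxSl _ _)) // perpK.
rewrite sub1mx -col_leq_rank.
have := rank_perp hN S; have := rank_mul_form kS; rank_lia.
Qed.

(** A vector of [G :&: (K + F)] is orthogonal to [K] and to [perp N (K + F)], hence to [G], and so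
    lies in [K]. Thus the isotropic space [Z] is large, while [K + G] stays inside [perp N Z];
    [pidx_isotropic] on the whole space gives the count. *)
Lemma pidx_add_perp N K F : hermitian_mx N -> (kermx N <= K)%MS ->
  (perp N K <= K + perp N (K + F)%MS)%MS ->
  (pidx N (K + perp N K)%MS + \rank (K + F)%MS <= pidx N (1%:M : 'M_n) + \rank K)%N.
Proof.
move=> hN kK h; set G := perp N K; set Z := (K :&: G)%MS.
have GFZ : (G :&: (K + F)%MS <= Z)%MS.
  rewrite sub_capmx capmxSl andbT -(perpK hN kK) perpC // (submx_trans h) //.
  rewrite addsmx_sub perpC // capmxSl /=.
  by rewrite perpC // (submx_trans (capmxSr _ _)) // perpK // (submx_trans kK) ?addsmxSl.
have kZ : (kermx N <= Z)%MS by rewrite sub_capmx kK kermx_perp.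
have ZZ : (Z <= perp N Z)%MS.
  by rewrite (submx_trans (capmxSr _ _)) // perpS // capmxSl.
have := pidx_isotropic hN (submx1 Z) ZZ; rewrite conjtmx1 mulmx1.
have : (pidx N (K + G)%MS <= pidx N (1%:M :&: perp N Z)%MS)%N.
  apply: pidxS => //; rewrite sub_capmx submx1 addsmx_sub /=.
  by rewrite perpC // capmxSr perpS // capmxSl.
have := mxrankS GFZ; have := mxrank_sum_cap G (K + F)%MS.
have := rank_leq_col (G + (K + F)%MS)%MS; have := rank_mul_form kZ.
have := rank_mul_form kK; have := rank_perp hN K; rewrite -/G.
rank_lia.
Qed.

(** [L] adds to [K] a complement of [K + F] chosen inside [perp N K], where the form is nonnegative,
    so the negative index does not grow. The same holds for [K + perp N K], which forces the
    positive index of the whole space to exceed that of [K] by at least the codimension of [K]. *)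
Lemma pidx_semidef N K F : hermitian_mx N -> (kermx N <= K)%MS ->
  nonpos (- N) (perp N K) -> (1%:M <= perp N K + (K + F)%MS)%MS ->
  exists L : 'M[C]_n, [/\ (K <= L)%MS, (1%:M <= L + F)%MS,
    (pidx (- N) L <= pidx (- N) K)%N &
    (pidx N L + \rank (K + F)%MS <= pidx N (1%:M : 'M_n) + \rank K)%N].
Proof.
move=> hN kK nG full; have hN' := hermitian_opp hN.
set G := perp N K in nG full; exists (K + (G :\: (K + F)%MS))%MS.
have GK : (G <= perp (- N) K)%MS by rewrite sub_perp_opp.
have DG := diffmxSl G (K + F)%MS.
split; first exact: addsmxSl.
- have KFL : (K + F <= K + (G :\: (K + F)%MS) + F)%MS by rewrite addsmxS ?addsmxSl.
  apply: submx_trans full _; rewrite addsmx_sub KFL andbT.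
  rewrite -(addsmx_diff_cap_eq G (K + F)%MS) addsmx_sub.
  rewrite (submx_trans (capmxSr _ _) KFL) andbT.
  exact: submx_trans (addsmxSr _ _) (addsmxSl _ _).
- apply: pidx_perp_nonpos => //; first exact: submx_trans GK.
  exact: nonposS nG.
have c := pidx_codim hN (addsmxSl K (G :\: (K + F)%MS)%MS).
have s := leq_of_leqif (mxrank_adds_leqif K (G :\: (K + F)%MS)%MS).
have p := pidx_perp_nonpos hN' GK nG.
have c' := pidx_codim hN' (submx1 (K + G)%MS).
have r1 := pidx_rank (1%:M : 'M_n) hN; have rK := pidx_rank K hN.
rewrite mul1mx conjtmx1 mulmx1 in r1.
have := rank_form N K K; rewrite -/G.
have := mxrank_sum_cap K G; have := mxrank_sum_cap G (K + F)%MS.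
have := mxrank_cap_compl G (K + F)%MS.
have : (\rank (G + (K + F)%MS) = n)%N.
  by apply/eqP; rewrite eqn_leq rank_leq_col col_leq_rank -sub1mx.
have := rank_mul_form kK; have := rank_perp hN K; rewrite -/G.
have := mxrank_ker N; have := rank_leq_row N; rewrite mxrank1 in c'.
move: c s p c' r1 rK; rank_lia.
Qed.

(** A vector of the new radical with a nonzero [v]-coordinate would put [v] in
    [K + perp N (K + F)]. *)
Lemma radical_adds N K F (v : 'rV_n) : ~~ (v <= K + perp N (K + F)%MS)%MS ->
  hermitian_mx N ->
  ((K + v)%MS :&: perp N (K + v + F)%MS <= K :&: perp N (K + F)%MS)%MS.
Proof.
move=> vK hN; apply/rV_subP => u; rewrite sub_capmx => /andP[/addsmx_rVP[k kK [a e]] up].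
have {}up : (u <= perp N (K + F)%MS)%MS.
  by rewrite (submx_trans up) // perpS // addsmxS ?addsmxSl.
rewrite sub_capmx up andbT; case: (eqVneq a 0) => [a0|a0].
  by rewrite e a0 scale0r addr0.
case/negP: vK; rewrite -(scalerK a0 v) scalemx_sub // (_ : a *: v = - k + u).
  by rewrite addmx_sub_adds // eqmx_opp.
by rewrite e addKr.
Qed.

(* The two alternatives are the two terms of the maximum bounding [pidx M L],
   rearranged to avoid truncated subtractions. *)
Definition min_bound N M K F L : bool :=
  (pidx M L + \rank (kermx N) <= pidx M K + \rank (K :&: perp N (K + F)%MS))%N ||
  (pidx M L + \rank (K + F) <= pidx M (1%:M : 'M_n) + \rank K)%N.

(** Adding [v] raises the ranks of [K] and [K + F] equally, which preserves the second alternative;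
    the hypothesis [h] preserves the first. *)
Lemma min_bound_step N M K F L (v : 'rV_n) : ~~ (v <= K + F)%MS ->
  (pidx M (K + v)%MS + \rank ((K + v)%MS :&: perp N (K + v + F)%MS) <=
    pidx M K + \rank (K :&: perp N (K + F)%MS))%N ->
  min_bound N M (K + v)%MS F L -> min_bound N M K F L.
Proof.
move=> vKF h; rewrite /min_bound addsmx_rot (rank_adds_rV vKF) rank_adds_rV; last first.
  by apply: contra vKF => vK; rewrite (submx_trans vK) ?addsmxSl.
by case/orP => h'; apply/orP; [left|right]; move: h h'; rank_lia.
Qed.

(** Induction on the codimension of [K + F], building one [L] for both signs. Since [K] contains the
    radical, [perpK] applies to it. *)
Lemma min_exists_radical N K F : hermitian_mx N -> (kermx N <= K)%MS ->
  exists L : 'M[C]_n, [/\ (K <= L)%MS, (1%:M <= L + F)%MS,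
    min_bound N N K F L & min_bound N (- N) K F L].
Proof.
move=> hN; have hN' := hermitian_opp hN.
move e : (n - \rank (K + F)%MS)%N => a; elim: a K e => [|a IH] K e kK.
  have r : (\rank (K + F)%MS = n)%N.
    by apply/eqP; rewrite eqn_leq rank_leq_col /= -subn_eq0 e.
  have full : (1%:M <= K + F)%MS by rewrite sub1mx -col_leq_rank r.
  have kZ : (\rank (kermx N) <= \rank (K :&: perp N (K + F)%MS))%N.
    by rewrite mxrankS // sub_capmx kK kermx_perp.
  by exists K; split => //; rewrite /min_bound leq_add2l kZ.
have KF : ~~ (1%:M <= K + F)%MS by rewrite sub1mx -col_leq_rank -subn_eq0 e.
set Z := (K :&: perp N (K + F)%MS)%MS.
have kZ : (kermx N <= Z)%MS by rewrite sub_capmx kK kermx_perp.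
have IHv (v : 'rV_n) : ~~ (v <= K + F)%MS ->
    (forall M, M = N \/ M = - N -> pidx M (K + v)%MS +
      \rank ((K + v)%MS :&: perp N (K + v + F)%MS) <= pidx M K + \rank Z)%N ->
    exists L : 'M[C]_n, [/\ (K <= L)%MS, (1%:M <= L + F)%MS,
      min_bound N N K F L & min_bound N (- N) K F L].
  move=> vKF h; have [||L [L1 L2 L3 L4]] := IH (K + v)%MS.
  - by rewrite addsmx_rot rank_adds_rV // subnS e.
  - by rewrite (submx_trans kK) ?addsmxSl.
  exists L; split => //.
  - by rewrite (submx_trans _ L1) ?addsmxSl.
  - by apply: min_bound_step vKF _ L3; apply: h; left.
  - by apply: min_bound_step vKF _ L4; apply: h; right.
(* If [Z] exceeds the radical of [N], some [x] in [Z] pairs with some [v], necessarily outside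
   [K + F]. Adding [v] raises each index by at most one and lowers the dimension of [Z] by at least
   one. *)
have [rZ|rZ] := leqP (\rank Z) (\rank (kermx N)); last first.
  have /avoid1[x xZ xk] : ~~ (Z <= kermx N)%MS.
    by apply: contraL rZ => h; rewrite -leqNgt mxrankS.
  have /avoid1[v _ vx] : ~~ (1%:M <= perp N x)%MS by rewrite perpC // sub_perp1.
  have xp : (x <= perp N (K + F)%MS)%MS by rewrite (submx_trans xZ) ?capmxSr.
  have xK : (x <= K)%MS by rewrite (submx_trans xZ) ?capmxSl.
  have vKF : ~~ (v <= K + F)%MS.
    by apply: contra vx => h; rewrite perpC // (submx_trans xp) ?perpS.
  have vKp : ~~ (v <= K + perp N (K + F)%MS)%MS.
    apply: contra vx => h; rewrite (submx_trans h) // addsmx_sub perpC //.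
    by rewrite (submx_trans xp) ?perpS ?addsmxSl //= (submx_trans xK) ?addsmxSl.
  apply: (IHv v) => // M hM.
  have hM' : hermitian_mx M by case: hM => ->.
  have : (\rank ((K + v)%MS :&: perp N (K + v + F)%MS) < \rank Z)%N.
    apply: rank_ltmx; rewrite /ltmx radical_adds //=; apply: contra vx => h.
    rewrite perpC // (submx_trans xZ) // (submx_trans h) // (submx_trans (capmxSr _ _)) //.
    by rewrite perpS // (submx_trans _ (addsmxSl _ _)) ?addsmxSr.
  have := pidx_codim hM' (addsmxSl K v); rewrite rank_adds_rV; last first.
    by apply: contra vKF => h; rewrite (submx_trans h) ?addsmxSl.
  rank_lia.
have full := perp_complement_full hN kK rZ.
have GF : ~~ (perp N K <= K + F)%MS.
  by apply: contra KF => h; rewrite (submx_trans full) // addsmx_sub h /=.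
have kK' : (kermx (- N) <= K)%MS.
  by apply: submx_trans kK; rewrite sub_kermx -oppr_eq0 -mulmxN mulmx_ker.
have pp (U : 'M[C]_n) : (perp N U <= perp (- N) U)%MS by rewrite sub_perp_opp.
have pp' (U : 'M[C]_n) : (perp (- N) U <= perp N U)%MS by rewrite -sub_perp_opp.
have triv M L : (pidx M L <= pidx M K)%N -> min_bound N M K F L.
  by move=> h; rewrite /min_bound leq_add // mxrankS.
(* With nothing of [perp N K] outside [K + perp N (K + F)], adding all of [perp N K] reaches the
   second alternative of [min_bound] for both signs. *)
case: (boolP (perp N K <= K + perp N (K + F)%MS)%MS) => GZ.
  exists (K + perp N K)%MS; split.
  - exact: addsmxSl.
  - rewrite (submx_trans full) // addsmx_sub addsmxS ?addsmxSl // andbT.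
    exact: submx_trans (addsmxSr K _) (addsmxSl _ _).
  - by apply/orP; right; apply: pidx_add_perp.
  apply/orP; right.
  apply: leq_trans (_ : pidx (- N) (K + perp (- N) K)%MS + \rank (K + F)%MS <= _)%N.
    by rewrite leq_add2r pidxS // addsmxS.
  apply: pidx_add_perp => //.
  by apply: submx_trans (pp' _) (submx_trans GZ _); rewrite addsmxS.
have [nG|nG|[v [vG vKF vKp v0]]] := isotropic_avoid2 hN GF GZ.
- have [||L [L1 L2 L3 L4]] := pidx_semidef (F := F) hN' kK'.
  + by rewrite opprK; apply: nonposS nG.
  + by apply: submx_trans full _; rewrite addsmxS.
  rewrite opprK in L3.
  by exists L; split => //; [apply: triv|apply/orP; right].
- have [L [L1 L2 L3 L4]] := pidx_semidef hN kK nG full.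
  by exists L; split => //; [apply/orP; right|apply: triv].
(* An isotropic vector of [perp N K] raises neither index, and its position outside
   [K + perp N (K + F)] keeps [Z] from growing. *)
apply: (IHv v) => // M hM; have hM' : hermitian_mx M by case: hM => ->.
apply: leq_add; last by apply: mxrankS; apply: radical_adds.
apply: pidx_perp_nonpos => //; first by case: hM => ->; [|rewrite sub_perp_opp].
move=> _ /sub_rVP[b ->]; rewrite sqformZ.
by case: hM => ->; [|rewrite sqformN]; rewrite v0 ?oppr0 mulr0.
Qed.

Lemma rank_formS N k l k' l' (U : 'M[C]_(k, n)) (U' : 'M[C]_(k', n))
    (V : 'M[C]_(l, n)) (V' : 'M[C]_(l', n)) :
  (U <= U')%MS -> (V <= V')%MS ->
  (\rank (U *m N *m V^h) <= \rank (U' *m N *m V'^h))%N.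
Proof.
move=> /submxP[T ->] /submxP[T' ->]; rewrite conjtmxM mulmxA.
apply: leq_trans (mxrankM_maxl _ _) _.
by rewrite -!(mulmxA T) mxrankM_maxr.
Qed.

(** Reduction to [min_exists_radical]: adding [kermx N] to [K] raises neither index and leaves the
    ranks of products with [N] unchanged. *)
Lemma min_exists N K F : hermitian_mx N ->
  exists L : 'M[C]_n, [/\ (K <= L)%MS, (1%:M <= L + F)%MS &
    forall M, M = N \/ M = - N ->
    (pidx M L + \rank (K *m N *m (K + F)%MS^h) <= pidx M K + \rank (K *m N))%N \/
    (pidx M L + \rank ((K + F)%MS *m N) <= pidx M (1%:M : 'M_n) + \rank (K *m N))%N].
Proof.
move=> hN; have hN' := hermitian_opp hN.
have [L [L1 L2 L3 L4]] := min_exists_radical F hN (addsmxSr K (kermx N)).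
exists L; split => // [|M hM]; first by rewrite (submx_trans _ L1) ?addsmxSl.
have {L3 L4} : min_bound N M (K + kermx N)%MS F L by case: hM => ->.
have pK : (pidx M (K + kermx N)%MS <= pidx M K)%N.
  apply: pidx_perp_nonpos.
  - by case: hM => ->.
  - by case: hM => ->; [|rewrite sub_perp_opp]; apply: kermx_perp.
  move=> u; rewrite sub_kermx => /eqP e.
  by case: hM => ->; [|rewrite sqformN]; rewrite /sqform e mul0mx mxE ?oppr0.
set K' := (K + kermx N)%MS in pK *.
have eK : (\rank (K' *m N) = \rank (K *m N))%N by rewrite addsmxMr mulmx_ker addsmx0.
have eKF : (\rank ((K' + F)%MS *m N) = \rank ((K + F)%MS *m N))%N.
  by rewrite (eqmxMr N (addsmx_rot K (kermx N) F)) addsmxMr mulmx_ker addsmx0.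
have eZ : (\rank (K *m N *m (K + F)%MS^h) <= \rank (K' *m N *m (K' + F)%MS^h))%N.
  by rewrite rank_formS ?addsmxS ?addsmxSl.
have kK : (kermx N <= K')%MS by apply: addsmxSr.
have kKF : (kermx N <= K' + F)%MS by rewrite (submx_trans kK) ?addsmxSl.
have := rank_form N K' (K' + F)%MS.
have := rank_mul_form kK; have := rank_mul_form kKF.
rewrite /min_bound eK eKF => r1 r2 r3 /orP[h|h]; [left|right];
  move: h r1 r2 r3 eZ pK; rank_lia.
Qed.

End Minimum.

(** * Block matrices and the parametrization by X *)

Section Blocks.
Variable C : numClosedFieldType.

Lemma conjtmx_block m1 m2 n1 n2 (A : 'M[C]_(m1, n1)) (B : 'M_(m1, n2))
    (D : 'M_(m2, n1)) (E : 'M_(m2, n2)) :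
  (block_mx A B D E)^h = block_mx A^h D^h B^h E^h.
Proof. by rewrite /conjtmx map_block_mx tr_block_mx. Qed.

(** Rank-nullity for the projection of the row space onto the last [p] columns. *)
Lemma rank_row_mx_ker n p q (X : 'M[C]_(n, q)) (A : 'M[C]_(n, p)) :
  \rank (row_mx X A) = (\rank A + \rank (kermx A *m X))%N.
Proof.
set T := row_mx X A.
have := mxrank_mul_ker T (col_mx 0 1%:M : 'M_(q + p, p)).
rewrite mul_row_col mulmx0 mulmx1 add0r => <-; congr (_ + _)%N.
rewrite -(rank_row_mx0 p (kermx A *m X)).
apply/eqmx_rank/andP; split.
  apply/rV_subP => u; rewrite sub_capmx => /andP[/submxP[x ->]].
  rewrite sub_kermx mul_mx_row mul_row_col mulmx0 mulmx1 add0r => /eqP e.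
  have /submxP[y ->] : (x <= kermx A)%MS by rewrite sub_kermx e.
  by rewrite -!(mulmxA y) mulmx_ker -mul_mx_row submxMl.
rewrite sub_capmx sub_kermx mul_row_col mulmx0 mul0mx addr0 eqxx andbT.
by rewrite -[X in row_mx _ X](mulmx_ker A) -mul_mx_row submxMl.
Qed.

Lemma kermx_col0 n m p (A : 'M[C]_(n, p)) :
  (kermx (col_mx A (0 : 'M_(m, p))) :=: block_mx (kermx A) 0 0 1%:M)%MS.
Proof.
apply/eqmxP/andP; split; last first.
  by rewrite sub_kermx mul_block_col mulmx_ker !mulmx0 !mul0mx !addr0 col_mx0.
apply/rV_subP => u; rewrite sub_kermx -{1}[u]hsubmxK mul_row_col mulmx0 addr0 => /eqP e.
have /submxP[y ey] : (lsubmx u <= kermx A)%MS by rewrite sub_kermx e.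
apply/submxP; exists (row_mx y (rsubmx u)).
by rewrite mul_row_block -ey !mulmx0 mulmx1 add0r addr0 hsubmxK.
Qed.

Lemma rank_block0 n m p q (X : 'M[C]_(n, q)) (A : 'M[C]_(n, p)) (Y : 'M_(m, q)) :
  \rank (block_mx X A Y 0) =
  (\rank A + \rank (block_mx (kermx A) 0 0 1%:M *m col_mx X Y))%N.
Proof.
by rewrite block_mxEh rank_row_mx_ker rank_col_mx0 (eqmxMr _ (kermx_col0 m A)).
Qed.

Lemma rank_col_mx_ker n p q (X : 'M[C]_(n, q)) (Y : 'M[C]_(p, q)) :
  \rank (col_mx X Y) = (\rank Y + \rank (X *m (kermx Y^h)^h))%N.
Proof.
rewrite -rank_conjtmx conjtmx_col rank_row_mx_ker rank_conjtmx; congr (_ + _)%N.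
by rewrite -rank_conjtmx conjtmxM conjtmxK.
Qed.

Lemma pidx1 n (N : 'M[C]_n) : pidx N (1%:M : 'M_n) = inertia_pos N.
Proof. by rewrite pidx.unlock mul1mx conjtmx1 mulmx1. Qed.

(** The compression of [N1] to [B], of codimension [\rank A], is [G] padded by zeros, so each
    inertia is at most [\rank A] plus that of [G]. The two bounds add up to the rank, hence both are
    equalities. *)
Lemma inertia_bordered n p (P : 'M[C]_n) (A : 'M_(n, p)) : hermitian_mx P ->
  let N1 := block_mx P A A^h 0 in let G := kermx A *m P *m (kermx A)^h in
  [/\ \rank N1 = (2 * \rank A + \rank G)%N,
      inertia_pos N1 = (\rank A + inertia_pos G)%N
    & inertia_neg N1 = (\rank A + inertia_neg G)%N].
Proof.
move=> hP N1 G.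
have hG : hermitian_mx G by apply: hermitian_sandwich.
have hN1 : hermitian_mx N1 by rewrite /hermitian_mx conjtmx_block hP conjtmxK conjtmx0.
have r1 : \rank N1 = (2 * \rank A + \rank G)%N.
  rewrite rank_block0 mul_block_col !mul0mx mul1mx add0r addr0 rank_col_mx_ker conjtmxK.
  by rewrite rank_conjtmx addnA addnn mul2n.
pose B : 'M_(n + p) := block_mx (kermx A) 0 0 1%:M.
have rB : (\rank B + \rank A = n + p)%N.
  rewrite rank_diag_block_mx mxrank1 mxrank_ker; have := rank_leq_row A; rank_lia.
pose E : 'M[C]_(n + p, n) := col_mx 1%:M 0.
have BNB : B *m N1 *m B^h = E *m G *m E^h.
  rewrite conjtmx_block !conjtmx0 !conjtmx1 conjtmx_col conjtmx1 conjtmx0.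
  rewrite !mulmx_block mul_col_mx mul_col_row !mulmx1 !mul1mx !mulmx0 !mul0mx !addr0 !add0r.
  have e : A^h *m (kermx A)^h = 0 by rewrite -conjtmxM mulmx_ker conjtmx0.
  by rewrite mulmx_ker e.
have le e : e = 1 \/ e = -1 ->
    (inertia_pos (e *: N1) <= \rank A + inertia_pos (e *: G))%N.
  move=> he; have hM : hermitian_mx (e *: N1).
    by rewrite /hermitian_mx conjtmxZ hN1; case: he => ->; rewrite ?rmorphN rmorph1.
  have hM' : hermitian_mx (e *: G).
    by rewrite /hermitian_mx conjtmxZ hG; case: he => ->; rewrite ?rmorphN rmorph1.
  have := pidx_codim hM (submx1 B); have := pidxS hM' (submx1 E).
  have -> : pidx (e *: G) E = pidx (e *: N1) B.
    by rewrite pidx.unlock -!scalemxAr -!scalemxAl BNB.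
  rewrite mxrank1 !pidx1; move: rB; rank_lia.
have p1 := le 1 (or_introl erefl); have p2 := le (-1) (or_intror erefl).
rewrite !scale1r in p1; rewrite !scaleN1r -!inertia_negE // in p2.
by split => //; move: p1 p2 r1; rewrite !rank_inertia //; rank_lia.
Qed.

End Blocks.

Section Parametrization.
Variables (C : numClosedFieldType) (n m p : nat) (A : 'M[C]_(n, p)).

(* The graphs are exactly the complements of [tail] containing [base]. *)
Definition base : 'M[C]_(n + m) := <<row_mx (kermx A) 0>>%MS.
Definition tail : 'M[C]_(n + m) := <<row_mx 0 1%:M : 'M_(m, n + m)>>%MS.
Definition graph (X : 'M[C]_(p, m)) : 'M[C]_(n, n + m) := row_mx 1%:M (A *m X).

Lemma base_tailE : (base + tail :=: block_mx (kermx A) 0 0 1%:M)%MS.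
Proof.
by rewrite block_mxEv; apply: eqmx_trans (adds_eqmx (genmxE _) (genmxE _)) (addsmxE _ _).
Qed.

Lemma rank_base : (\rank base + \rank A = n)%N.
Proof. by rewrite genmxE rank_row_mx0 mxrank_ker subnK ?rank_leq_row. Qed.

Lemma rank_base_tail : (\rank (base + tail)%MS = \rank base + m)%N.
Proof. by rewrite base_tailE rank_diag_block_mx mxrank1 genmxE rank_row_mx0. Qed.

Lemma rank_graph X : \rank (graph X) = n.
Proof.
apply/eqP/row_freeP; exists (col_mx 1%:M 0).
by rewrite mul_row_col mulmx1 mulmx0 addr0.
Qed.

Lemma base_graph X : (base <= graph X)%MS.
Proof.
rewrite genmxE; apply/submxP; exists (kermx A).
by rewrite mul_mx_row mulmx1 mulmxA mulmx_ker mul0mx.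
Qed.

Lemma graph_tail X : (1%:M <= graph X + tail)%MS.
Proof.
rewrite scalar_mx_block block_mxEv -addsmxE addsmx_sub andbC.
rewrite (submx_trans _ (addsmxSr _ _)) ?genmxE //=.
have -> : row_mx 1%:M 0 = graph X - (A *m X) *m row_mx 0 1%:M.
  by rewrite mul_mx_row mulmx0 mulmx1 opp_row_mx add_row_mx oppr0 addr0 subrr.
by rewrite addmx_sub_adds // eqmx_opp genmxE submxMl.
Qed.

(** Splitting [[1, 0]] along [L] and [tail] puts some [[1, -V]] in [L]. The columns of [V] need not
    come from [A], so [V] is projected by [J = A *m pinvmx A]; the error has the form [[1 - J, 0]]
    with [(1 - J) *m A = 0] and lies in [base]. *)
Lemma graph_exists (L : 'M[C]_(n + m)) : (base <= L)%MS -> (1%:M <= L + tail)%MS ->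
  exists X, (graph X <= L)%MS.
Proof.
rewrite genmxE => KL full.
have /sub_addsmxP[[U V] /= e] : (row_mx 1%:M 0 <= L + (row_mx 0 1%:M : 'M_(m, n + m)))%MS.
  apply: submx_trans (submx1 _) (submx_trans full _).
  by rewrite addsmxS // genmxE.
have UL : U *m L = row_mx 1%:M (- V).
  rewrite -[LHS](addrK (V *m row_mx 0 1%:M)) -e mul_mx_row mulmx0 mulmx1.
  by rewrite opp_row_mx add_row_mx oppr0 addr0 add0r.
exists (pinvmx A *m - V); set J := A *m pinvmx A.
have -> : graph (pinvmx A *m - V) = J *m row_mx 1%:M (- V) + row_mx (1%:M - J) 0.
  by rewrite /graph mul_mx_row add_row_mx mulmx1 addrC subrK addr0 mulmxA.
apply: addmx_sub; first by rewrite -UL mulmxA submxMl.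
have /submxP[T ->] : (1%:M - J <= kermx A)%MS.
  by rewrite sub_kermx mulmxBl mul1mx mulmxKpV ?subrr.
apply: submx_trans KL; apply/submxP; exists T.
by rewrite mul_mx_row mulmx0.
Qed.

Lemma graph_exists_eq (L : 'M[C]_(n + m)) : (base <= L)%MS -> (1%:M <= L + tail)%MS ->
  (\rank L + \rank (base + tail)%MS = \rank base + (n + m))%N ->
  exists X, (L <= graph X)%MS.
Proof.
move=> KL full rL; have [X XL] := graph_exists KL full; exists X.
have := mxrank_leqif_sup XL; rewrite rank_graph => -[_ <-].
move: rL; rewrite rank_base_tail; rank_lia.
Qed.

Variable N : 'M[C]_(n + m).
Hypothesis hN : hermitian_mx N.

Lemma graph_pidx_le X : (pidx N (graph X) <= \rank A + pidx N base)%N.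
Proof.
have := pidx_codim hN (base_graph X); rewrite rank_graph.
have := rank_base; rank_lia.
Qed.

Lemma graph_rank_le X :
  (\rank (graph X *m N *m (graph X)^h) <= \rank A + \rank (base *m N))%N.
Proof.
have := rank_form_le N (base_graph X); rewrite rank_graph.
have := rank_base; rank_lia.
Qed.

Lemma graph_max_pidx : exists X,
  (minn (\rank A + pidx N base) (pidx N (1%:M : 'M_(n + m))) <= pidx N (graph X))%N.
Proof.
have [L [L1 L2 L3 L4]] := max_pidx_exists base tail hN.
have [X LX] := graph_exists_eq L1 L2 L3; exists X.
apply: leq_trans (pidxS hN LX); apply: leq_trans L4.
by rewrite rank_base_tail; have := rank_base; rank_lia.
Qed.

Lemma graph_max_rank : exists X,
  (minn (\rank A + \rank (base *m N))
     (minn (2 * \rank A + \rank (base *m N *m base^h)) (\rank N))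
  <= \rank (graph X *m N *m (graph X)^h))%N.
Proof.
have [L [L1 L2 L3 L4]] := max_rank_exists base tail hN.
have [X LX] := graph_exists_eq L1 L2 L3; exists X.
apply: leq_trans (rank_formS N LX LX); apply: leq_trans L4.
by rewrite rank_base_tail; have := rank_base; rank_lia.
Qed.

Lemma graph_min : exists X, forall M, M = N \/ M = - N ->
  (pidx M (graph X) + \rank (base *m N *m (base + tail)%MS^h)
     <= pidx M base + \rank (base *m N))%N \/
  (pidx M (graph X) + \rank ((base + tail)%MS *m N)
     <= pidx M (1%:M : 'M_(n + m)) + \rank (base *m N))%N.
Proof.
have [L [L1 L2 L3]] := min_exists base tail hN.
have [X XL] := graph_exists L1 L2; exists X => M hM.
have hM' : hermitian_mx M by case: hM => -> //; apply: hermitian_opp.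
have le := pidxS hM' XL.
by case: (L3 M hM) => h; [left|right]; apply: leq_trans h; rewrite leq_add2r.
Qed.

End Parametrization.

(** * Block ranks and inertias in terms of [base] and [tail] *)

Section Translation.
Variables (C : numClosedFieldType) (n m p : nat) (A : 'M[C]_(n, p)).
Variables (P : 'M[C]_n) (Q : 'M[C]_(n, m)) (S : 'M[C]_m).
Hypotheses (hP : hermitian_mx P) (hS : hermitian_mx S).
Let N := block_mx P Q Q^h S.

Lemma hermitian_block : hermitian_mx N.
Proof. by rewrite /hermitian_mx conjtmx_block hP hS conjtmxK. Qed.

Lemma base_form : let G := kermx A *m P *m (kermx A)^h in
  [/\ \rank (base m A *m N *m (base m A)^h) = \rank G,
      pidx N (base m A) = inertia_pos G & pidx (- N) (base m A) = inertia_neg G].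
Proof.
move=> G; have hG : hermitian_mx G by apply: hermitian_sandwich.
have hN := hermitian_block; have hN' := hermitian_opp hN.
pose B : 'M_(n, n + m) := row_mx (kermx A) 0.
have BN : B *m N *m B^h = G.
  rewrite mul_row_block !mul0mx !addr0 conjtmx_row conjtmx0 mul_row_col mulmx0 addr0 //.
have eB (M : 'M_(n + m)) : hermitian_mx M -> pidx M (base m A) = pidx M B.
  by move=> hM; apply/eqP; rewrite eqn_leq !pidxS ?genmxE.
rewrite !eB // inertia_negE // -BN; split.
- by apply/eqP; rewrite eqn_leq !rank_formS ?genmxE.
- by rewrite pidx.unlock.
- by rewrite pidx.unlock mulmxN mulNmx.
Qed.

Lemma rank_base_mul : \rank (row_mx (row_mx P Q) A) = (\rank A + \rank (base m A *m N))%N.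
Proof.
rewrite rank_row_mx_ker (eqmxMr N (genmxE _)); congr (_ + \rank _)%N.
by rewrite /N block_mxEv mul_row_col mul0mx addr0.
Qed.

(** The borders [A] and [A^h] contribute [\rank A] each; eliminating them restricts the rows to
    [base] and the columns to [base + tail]. *)
Lemma rank_N2 :
  \rank (col_mx (row_mx (row_mx P Q) A) (row_mx (row_mx A^h 0) 0)) =
  (2 * \rank A + \rank (base m A *m N *m (base m A + tail C n m)%MS^h))%N.
Proof.
rewrite -block_mxEv rank_block0 mul_block_col !mul0mx mul1mx addr0 add0r rank_col_mx_ker.
rewrite rank_row_mx0 rank_conjtmx addnA addnn mul2n; congr (_ + _)%N.
have e : kermx A *m row_mx P Q = row_mx (kermx A) 0 *m N.
  by rewrite /N block_mxEv mul_row_col mul0mx addr0.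
rewrite e conjtmx_row conjtmxK conjtmx0; apply/eqP; rewrite eqn_leq.
by rewrite !rank_formS ?genmxE // base_tailE kermx_col0 submx_refl.
Qed.

Lemma rank_N4 :
  \rank (col_mx (row_mx (row_mx P Q) A) (row_mx (row_mx Q^h S) 0)) =
  (\rank A + \rank ((base m A + tail C n m)%MS *m N))%N.
Proof.
rewrite -block_mxEv rank_block0; congr (_ + _)%N.
by rewrite (eqmxMr N (base_tailE m A)) /N [in RHS]block_mxEv.
Qed.

End Translation.

(** * Assembly of the bounds and of the extremal [X] *)

Theorem theorem4p1 (C : numClosedFieldType) (n p m q : nat)
  (A : 'M[C]_(n, p)) (B : 'M[C]_(m, q)) (Cm : 'M[C]_(n, q))
  (D : 'M[C]_n) (M : 'M[C]_q)
  (hD : hermitian_mx D) (hM : hermitian_mx M) :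
  let phi := fun X : 'M[C]_(p, m) =>
    (A *m X *m B + Cm) *m M *m conjtmx (A *m X *m B + Cm) + D in
  let P := D + Cm *m M *m conjtmx Cm in
  let Q := Cm *m M *m conjtmx B in
  let R := B *m M *m conjtmx Cm in
  let S := B *m M *m conjtmx B in
  let N1 : 'M[C]_(n + p) := block_mx P A (conjtmx A) 0 in
  let N2 : 'M[C]_(n + p, n + m + p) :=
    col_mx (row_mx (row_mx P Q) A) (row_mx (row_mx (conjtmx A) 0) 0) in
  let N3 : 'M[C]_(n + m) := block_mx P Q R S in
  let N4 : 'M[C]_(n + m, n + m + p) :=
    col_mx (row_mx (row_mx P Q) A) (row_mx (row_mx R S) 0) in
  let rPQA := \rank (row_mx (row_mx P Q) A) in
  let s1 : int := (\rank N1)%:Z - 2 * (\rank N2)%:Z in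
  let s2 : int := (\rank N3)%:Z - 2 * (\rank N4)%:Z in
  let s3 : int := (inertia_pos N1)%:Z + (inertia_neg N3)%:Z - (\rank N2)%:Z - (\rank N4)%:Z in
  let s4 : int := (inertia_neg N1)%:Z + (inertia_pos N3)%:Z - (\rank N2)%:Z - (\rank N4)%:Z in
  (* max rank *)
  ((forall X, \rank (phi X) <= minn rPQA (minn (\rank N1) (\rank N3)))%N /\
   exists X, \rank (phi X) = minn rPQA (minn (\rank N1) (\rank N3))) /\
  (* min rank *)
  ((forall X, 2 * rPQA%:Z + Num.max (Num.max s1 s2) (Num.max s3 s4)
              <= (\rank (phi X))%:Z) /\
   exists X, (\rank (phi X))%:Z
             = 2 * rPQA%:Z + Num.max (Num.max s1 s2) (Num.max s3 s4)) /\
  (* max i_+ *)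
  ((forall X, inertia_pos (phi X) <= minn (inertia_pos N1) (inertia_pos N3))%N /\
   exists X, inertia_pos (phi X) = minn (inertia_pos N1) (inertia_pos N3)) /\
  (* max i_- *)
  ((forall X, inertia_neg (phi X) <= minn (inertia_neg N1) (inertia_neg N3))%N /\
   exists X, inertia_neg (phi X) = minn (inertia_neg N1) (inertia_neg N3)) /\
  (* min i_+ *)
  ((forall X, rPQA%:Z + Num.max ((inertia_pos N1)%:Z - (\rank N2)%:Z)
                                 ((inertia_pos N3)%:Z - (\rank N4)%:Z)
              <= (inertia_pos (phi X))%:Z) /\
   exists X, (inertia_pos (phi X))%:Z = rPQA%:Z + Num.max ((inertia_pos N1)%:Z - (\rank N2)%:Z)
                                                   ((inertia_pos N3)%:Z - (\rank N4)%:Z)) /\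
  (* min i_- *)
  ((forall X, rPQA%:Z + Num.max ((inertia_neg N1)%:Z - (\rank N2)%:Z)
                                 ((inertia_neg N3)%:Z - (\rank N4)%:Z)
              <= (inertia_neg (phi X))%:Z) /\
   exists X, (inertia_neg (phi X))%:Z = rPQA%:Z + Num.max ((inertia_neg N1)%:Z - (\rank N2)%:Z)
                                                   ((inertia_neg N3)%:Z - (\rank N4)%:Z)).
Proof.
move=> phi P Q R S N1 N2 N3 N4 rPQA s1 s2 s3 s4.
have hP : hermitian_mx P by rewrite /hermitian_mx conjtmxD hD hermitian_sandwich.
have hS : hermitian_mx S by apply: hermitian_sandwich.
have eR : R = Q^h by rewrite /R /Q !conjtmxM conjtmxK hM mulmxA.
have hN : hermitian_mx N3 by rewrite /N3 eR; apply: hermitian_block.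
have hN' := hermitian_opp hN.
set K := base m A; set KF := (K + tail C n m)%MS.
have phiE X : phi X = graph A X *m N3 *m (graph A X)^h.
  rewrite /phi /N3 /graph mul_row_block conjtmx_row mul_row_col !conjtmx1 !mul1mx mulmx1.
  rewrite /P /Q /R /S conjtmxD !(conjtmxM _ B) !(mulmxDl, mulmxDr) !mulmxA !addrA.
  by rewrite [LHS](ACl (5*4*2*3*1))%AC.
have [rK pK nK] : [/\ \rank N1 = (2 * \rank A + \rank (K *m N3 *m K^h))%N,
    inertia_pos N1 = (\rank A + pidx N3 K)%N & inertia_neg N1 = (\rank A + pidx (- N3) K)%N].
  have [] := inertia_bordered A hP; have [] := base_form A Q hP hS.
  by rewrite -eR => -> -> ->.
have r2 : \rank N2 = (2 * \rank A + \rank (K *m N3 *m KF^h))%N.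
  by rewrite /N2 (rank_N2 A P Q S) -eR.
have r4 : \rank N4 = (\rank A + \rank (KF *m N3))%N.
  by rewrite /N4 eR rank_N4 -eR.
have rr : rPQA = (\rank A + \rank (K *m N3))%N.
  by rewrite /rPQA (rank_base_mul A P Q S) -eR.
have ip X : inertia_pos (phi X) = pidx N3 (graph A X) by rewrite phiE pidx.unlock.
have im X : inertia_neg (phi X) = pidx (- N3) (graph A X).
  by rewrite phiE inertia_negE ?pidx.unlock ?mulmxN ?mulNmx //; apply: hermitian_sandwich.
have ir X : \rank (phi X) = (inertia_pos (phi X) + inertia_neg (phi X))%N.
  by rewrite rank_inertia // phiE; apply: hermitian_sandwich.
have pN := pidx1 N3; have nN := pidx1 (- N3); rewrite -inertia_negE // in nN.
have rN := rank_inertia hN.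
have KN' : \rank (K *m - N3) = \rank (K *m N3) by rewrite mulmxN mxrank_opp.
have KFN' : \rank (KF *m - N3) = \rank (KF *m N3) by rewrite mulmxN mxrank_opp.
have KKN' : \rank (K *m - N3 *m KF^h) = \rank (K *m N3 *m KF^h).
  by rewrite mulmxN mulNmx mxrank_opp.
have gK := pidx_rank K hN.
have u1 X : (inertia_pos (phi X) <= \rank A + pidx N3 K)%N by rewrite ip graph_pidx_le.
have u2 X : (inertia_neg (phi X) <= \rank A + pidx (- N3) K)%N by rewrite im graph_pidx_le.
have u3 X : (inertia_pos (phi X) <= inertia_pos N3)%N by rewrite ip -pN pidxS ?submx1.
have u4 X : (inertia_neg (phi X) <= inertia_neg N3)%N by rewrite im -nN pidxS ?submx1.
have u5 X : (inertia_pos (phi X) + inertia_neg (phi X) <= \rank A + \rank (K *m N3))%N.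
  by rewrite -ir phiE graph_rank_le.
have l1 X : (pidx N3 K + \rank (K *m N3) <= inertia_pos (phi X) + \rank (K *m N3 *m KF^h))%N.
  by rewrite ip; apply: pidx_ge_sub (base_graph _ _) (graph_tail _ _).
have l2 X : (pidx (- N3) K + \rank (K *m N3) <= inertia_neg (phi X) + \rank (K *m N3 *m KF^h))%N.
  by rewrite im -KKN' -KN'; apply: pidx_ge_sub (base_graph _ _) (graph_tail _ _).
have l3 X : (inertia_pos N3 + \rank (K *m N3) <= inertia_pos (phi X) + \rank (KF *m N3))%N.
  by rewrite ip -pN; apply: pidx_ge_full (base_graph _ _) (graph_tail _ _).
have l4 X : (inertia_neg N3 + \rank (K *m N3) <= inertia_neg (phi X) + \rank (KF *m N3))%N.
  by rewrite im -nN -KFN' -KN'; apply: pidx_ge_full (base_graph _ _) (graph_tail _ _).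
(* [X1] serves the maximal rank, [X2] all three minima, [X3] and [X4] the maximal positive and
   negative inertia. *)
have [X1] := graph_max_rank A hN; rewrite -phiE ir -/K rN gK => x1.
have [X2 x2] := graph_min A hN.
have x2p := x2 _ (or_introl erefl); have x2n := x2 _ (or_intror erefl).
rewrite -/K -/KF pN -ip in x2p; rewrite -/K -/KF nN -im in x2n.
have [X3] := graph_max_pidx A hN; rewrite -/K pN -ip => x3.
have [X4] := graph_max_pidx A hN'; rewrite -/K nN -im => x4.
rewrite /s1 /s2 /s3 /s4 rK pK nK r2 r4 rr rN gK.
(* Only integer arithmetic remains: [bounds] collects the inequalities valid for every [X], and the
   facts about [X1] to [X4] give attainment. *)
have bounds X := conj (conj (conj (u1 X) (u2 X)) (conj (u3 X) (u4 X)))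
  (conj (u5 X) (conj (conj (l1 X) (l2 X)) (conj (l3 X) (l4 X)))).
clear - ir bounds x1 x2p x2n x3 x4.
split; [|split; [|split; [|split; [|split]]]]; (split=> [X|]).
all: try (by move: (bounds X); rewrite ?ir; clear; rank_lia).
- by exists X1; rewrite ir; move: (bounds X1) x1; clear; rank_lia.
- by exists X2; rewrite ir; move: (bounds X2) x2p x2n; clear; rank_lia.
- by exists X3; move: (bounds X3) x3; clear; rank_lia.
- by exists X4; move: (bounds X4) x4; clear; rank_lia.
- by exists X2; move: (bounds X2) x2p; clear; rank_lia.
- by exists X2; move: (bounds X2) x2n; clear; rank_lia.
Qed.
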